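(* The transition function $P$ possesses a unique invariant probability measure, i.e. there is one, and only one, probability measure $\mu: \mathfrak{B}(V)\rightarrow [0,1]$ such that $$\int_{V} P(t,v,B)\, \mu (dv)=\mu(B),\quad \forall t \geq 0,~B \in \mathfrak{B}(V).$$
   Context: $(\Omega,\mathcal{F},\mathbb{P})$ is a complete probability space, $(V,\|\cdot\|_V)$ is a separable real Banach space, $V\ne\{0\}$, with Borel $\sigma$-algebra $\mathfrak{B}(V)$, and $\mathcal{M}(\Omega;V)$ is the set of all $V$-valued random variables ($\mathcal{F}$-$\mathfrak{B}(V)$-measurable maps). A semigroup on $V$ is a family of (not necessarily linear) maps $T(t):V\to V$, $t\ge 0$, with $T(0)v=v$ and $T(t+h)v=T(t)T(h)v$ for all $t,h\ge0$, $v\in V$; it is time-continuous if $t\mapsto T(t)v$ is continuous on $[0,\infty)$ for every $v\in V$, and contractive if $\|T(t)v_1-T(t)v_2\|_V\le\|v_1-v_2\|_V$ for all $t\ge0$, $v_1,v_2\in V$. Standing assumptions: $(T(t))_{t\ge0}$ is a time-continuous, contractive semigroup on $V$; $(\eta_m)_{m\in\mathbb{N}}\subseteq\mathcal{M}(\Omega;V)$ is i.i.d. with $\|\eta_k\|_V\in L^2(\Omega)$ for all $k$; $(\beta_m)_{m\in\mathbb{N}}$, $\beta_m:\Omega\to(0,\infty)$, is an i.i.d. sequence of exponentially distributed random variables with parameter $\theta\in(0,\infty)$; the two sequences are independent of each other. Moreover there is a separable Banach space $(W,\|\cdot\|_W)$, $W\subseteq V$, such that: (1) the injection $W\hookrightarrow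 V$ is continuous and $W$ is dense in $(V,\|\cdot\|_V)$; (2) $T(t)w\in W$ for all $w\in W$, $t\ge0$; (3) there are constants $\kappa,\rho\in(0,\infty)$ with $\|T(t)w_1-T(t)w_2\|_W\le\big(\kappa t+\|w_1-w_2\|_W^{-1/\rho}\big)^{-\rho}$ for all $w_1,w_2\in W$, $t\in[0,\infty)$, where the right-hand side is understood as $0$ if $w_1=w_2$; (4) $T(t)0=0$ for all $t\ge0$. Set $\alpha_0:=0$, $\alpha_m:=\sum_{k=1}^m\beta_k$. For $v\in V$ set $\mathsf{x}_{v,0}:=v$, $\mathsf{x}_{v,m}:=T(\beta_m)\mathsf{x}_{v,m-1}+\eta_m$ for $m\in\mathbb{N}$, and $\mathbb{X}_v(t):=\sum_{m=0}^\infty T((t-\alpha_m)_+)(\mathsf{x}_{v,m})\mathbf{1}_{[\alpha_m,\alpha_{m+1})}(t)$ for $t\ge0$. The transition function is $P(t,v,B):=\mathbb{P}(\mathbb{X}_v(t)\in B)$ for $t\ge0$, $v\in V$, $B\in\mathfrak{B}(V)$. *)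

(* Defs.v *)
From HB Require Import structures.
From mathcomp Require Export all_boot all_order all_algebra.
From mathcomp Require Export finmap.
From mathcomp Require Export all_classical all_reals all_analysis.
Export Order.TTheory GRing.Theory Num.Theory.
Export numFieldNormedType.Exports.

Set Implicit Arguments.
Unset Strict Implicit.
Unset Printing Implicit Defensive.

Local Open Scope classical_set_scope.
Local Open Scope ring_scope.

Definition separable_space (T : topologicalType) : Prop :=
  exists2 D : set T, countable D & dense D.

Definition borelType (T : ptopologicalType) := g_sigma_algebraType (@open T).

Section Independence.
Context d (Omega : measurableType d) (R : realType) (P : probability Omega R).

Definition mutually_independent d' (E : measurableType d')
    (X : nat -> {RV P >-> E}) : Prop :=
  forall (J : {fset nat}) (B : nat -> set E),
    (forall j, j \in J -> measurable (B j)) ->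
    P (\bigcap_(j in [set` J]) X j @^-1` B j) =
    (\prod_(j <- J) P (X j @^-1` B j))%E.

Definition iid d' (E : measurableType d') (X : nat -> {RV P >-> E}) : Prop :=
  mutually_independent X /\
  forall m (B : set E), measurable B ->
    distribution P (X m) B = distribution P (X 0%N) B.

Definition sigma_of_sequence d' (E : measurableType d')
    (X : nat -> {RV P >-> E}) : set (set Omega) :=
  <<s [set A | exists m, exists2 B, measurable B & A = X m @^-1` B] >>.

Definition independent_sequences d1 (E1 : measurableType d1)
    d2 (E2 : measurableType d2)
    (X : nat -> {RV P >-> E1}) (Y : nat -> {RV P >-> E2}) : Prop :=
  forall A B, sigma_of_sequence X A -> sigma_of_sequence Y B ->
    (P (A `&` B) = P A * P B)%E.

Definition exponentially_distributed (theta : R) (X : {RV P >-> R}) : Prop :=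
  forall B : set R, measurable B ->
    distribution P X B = exponential_prob theta B.

End Independence.

(* A semigroup (T(t))_{t >= 0} is a function on all of R of which only the
   values at t >= 0 are ever used or constrained. *)
Section Semigroup.
Context (R : realType) (V : normedModType R).
Implicit Type T : R -> V -> V.

Definition semigroup T : Prop :=
  (forall v, T 0 v = v) /\
  (forall t h v, 0 <= t -> 0 <= h -> T (t + h) v = T t (T h v)).

Definition time_continuous T : Prop :=
  forall v, {within `[0, +oo[%classic, continuous (fun t => T t v)}.

Definition contractive T : Prop :=
  forall t v1 v2, 0 <= t -> `|T t v1 - T t v2| <= `|v1 - v2|.

(* A subspace W of V with its own norm is an abstract normed space together
   with its injection into V. *)
Definition leaves_invariant (W : normedModType R) (inj : W -> V) T : Prop :=
  forall t w, 0 <= t -> range inj (T t (inj w)).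

Definition decay (kappa rho t r : R) : R :=
  if r == 0 then 0 else (kappa * t + r `^ (- rho^-1)) `^ (- rho).

(* [u1] and [u2] are the elements T(t)w1 and T(t)w2, viewed in W. *)
Definition decay_estimate (W : normedModType R) (inj : W -> V) T
    (kappa rho : R) : Prop :=
  forall t (w1 w2 u1 u2 : W), 0 <= t ->
    inj u1 = T t (inj w1) -> inj u2 = T t (inj w2) ->
    `|u1 - u2| <= decay kappa rho t `|w1 - w2|.

End Semigroup.

(* [eta m] and [beta m] stand for the (m+1)-st members of the sequences indexed
   from 1. *)
Section Process.
Context d (Omega : measurableType d) (R : realType) (P : probability Omega R).
Context (V : completeNormedModType R) (T : R -> V -> V).
Context (eta : nat -> {RV P >-> borelType V}) (beta : nat -> {RV P >-> R}).

Definition arrival (m : nat) (w : Omega) : R := \sum_(k < m) beta k w.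

Fixpoint chain (v : V) (m : nat) (w : Omega) : V :=
  if m is k.+1 then T (beta k w) (chain v k w) + (eta k w : V) else v.

Definition process (v : V) (t : R) (w : Omega) : V :=
  limn (series (fun m =>
    (\1_(`[arrival m w, arrival m.+1 w[%classic) t : R) *:
      T (Num.max 0 (t - arrival m w)) (chain v m w))).

Definition transition (t : R) (v : V) (B : set (borelType V)) : \bar R :=
  P [set w | B (process v t w)].

Definition invariant_measure (mu : probability (borelType V) R) : Prop :=
  forall (t : R) (B : set (borelType V)), 0 <= t -> measurable B ->
    (\int[mu]_v transition t v B = mu B)%E.

End Process.

(* Main.v *)
From HB Require Import structures.
Require Import Defs.
From mathcomp Require Import measurable_realfun ring lra.

Set Implicit Arguments.
Unset Strict Implicit.
Unset Printing Implicit Defensive.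

Local Open Scope classical_set_scope.
Local Open Scope ring_scope.

(** Uniqueness and existence of the invariant law both rest on one feature of
the semigroup: the decay estimate on W does not depend on the two starting
points.  Since W is dense and its injection is bounded, it gives
`|T t v - T t w| <= C * (kappa * t) ^ (- rho) for all v and w in V, so the
whole space is nearly contracted to a point by any long enough waiting time
([decay_coalesce]).  Exponential waiting times are unbounded, so almost surely
a long gap occurs.

Uniqueness.  Run two copies of the process from different points with the same
gaps and the same jumps.  All maps involved are 1-Lipschitz, hence after one
long gap the two copies stay close, uniformly in the starting points
([process_coalesce]).  So the transition probabilities from any two points
agree up to thickening the target set and a small error
([transition_couple]); integrating against two invariant measures identifies
them ([invariant_unique]).

Existence.  Write S for the flow and consider the backward composition
Y_n = S(b_0)(y_0 + S(b_1)(y_1 + ... S(b_(n-1))(y_(n-1)))).  The step n + 1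
changes only the innermost argument, and each long gap makes the image of V
small, so Y_n converges almost surely to some Z ([cvg_backward]).  By
independence the law of Y_(n+1) is obtained from that of Y_n by one step
z |-> S(b)(y + z), with b and y drawn afresh; this step is 1-Lipschitz, so in
the limit the law mu of Z is a fixed point of it ([stationary_law_fixpoint]).

It remains to pass from the discrete fixed point equation to the process.  For
the process started from mu, split the expectation of f (X t) according to the
number k of jumps before time t ([jump_part]).  Conditioning on the time b
elapsed since the last jump, which requires reading the Poisson process
backwards in time ([exponential_reflection]), expresses part k + 1 at time t
through part k at time t - b ([jump_partS]).  Together with the fixed point
equation and the absence of memory of the exponential law this gives, by
induction on the number of jumps, that the first n parts together are at most
the integral of f against mu ([sum_jump_part_le]).  Letting n tend to infinity,
the law at time t is bounded by mu on every Borel set, and an inequality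
between two probability measures is an equality ([fixpoint_invariant]). *)

(** * Borel measurability in separable normed spaces *)

Section borel_measurability.
Context (R : realType) (V : completeNormedModType R).

Lemma open_borel (A : set V) : open A -> measurable (A : set (borelType V)).
Proof. exact: sub_sigma_algebra. Qed.

Lemma closed_borel (A : set V) : closed A -> measurable (A : set (borelType V)).
Proof.
move=> cA; rewrite -[A]setCK; apply: measurableC.
by apply: open_borel; exact: closed_openC.
Qed.

Lemma measurable_dist (u : V) :
  measurable_fun [set: borelType V] (fun v : borelType V => `|(v : V) - u|).
Proof.
apply: (measurability _ (RGenInftyO.measurableE R)) => _ [_ [r ->] <-].
rewrite setTI (_ : _ @^-1` _ = ball u r); first by apply: open_borel; exact: ball_open.
  by apply/seteqP; split => v /=; rewrite in_itv /= -ball_normE /= distrC.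
Qed.

End borel_measurability.

Section separable_measurability.
Context (R : realType) (V : completeNormedModType R).
Hypothesis V_separable : separable_space V.

Lemma dense_sequence : exists u : nat -> V,
  forall (v : V) (e : R), 0 < e -> exists i, `|u i - v| < e.
Proof.
have [D /countable_injP[f finj] dD] := V_separable.
exists (fun n => xget 0 [set x | D x /\ f x = n]) => v e e0.
have [||x [vx Dx]] := dD (ball v e).
- by exists v; exact: ballxx.
- exact: ball_open.
exists (f x); rewrite (_ : xget _ _ = x).
  by rewrite distrC; move: vx; rewrite -ball_normE.
case: xgetP => [y _ [Dy fyx]|/(_ x)[]//].
by apply: finj; rewrite ?inE.
Qed.

Context d (X : measurableType d).

(** An open set is a countable union of balls centred at the points of a dense
sequence, so the distances to fixed points generate the Borel sets. *)
Lemma measurable_of_dist (f : X -> V) :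
  (forall u (r : R), measurable [set x | `|f x - u| < r]) ->
  measurable_fun setT (f : X -> borelType V).
Proof.
move=> mf; have [u uP] := dense_sequence.
apply: (@measurability _ _ X (borelType V) setT f (@open V) _) => //.
move=> _ [U oU <-]; rewrite setTI.
pose I i := [set n : nat | forall z, `|z - u i| < n.+1%:R^-1 -> U z].
rewrite (_ : _ @^-1` _ =
    \bigcup_i \bigcup_(n in I i) [set x | `|f x - u i| < n.+1%:R^-1]).
  by apply: bigcupT_measurable => i; apply: bigcup_measurable => n _; exact: mf.
apply/seteqP; split => [x /= Ux|x [i _ [n In /= /In]]//].
have /nbhs_ballP[e e0 /= eU] : nbhs (f x) U by exact: open_nbhs_nbhs.
have [n ne] : exists n, n.+1%:R^-1 < e / 2.
  have e2 : 0 < e / 2 by rewrite divr_gt0.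
  have [n _ /(_ n (leqnn n)) h] := near_infty_natSinv_lt (PosNum e2).
  by exists n.
have n0 : 0 < n.+1%:R^-1 :> R by rewrite invr_gt0.
have [i ui] := uP (f x) _ n0.
exists i => //; exists n => /=; last by rewrite distrC.
move=> z zi; apply: eU; rewrite -ball_normE /=.
rewrite -(subrKA (u i)) (le_lt_trans (ler_normD _ _))//.
rewrite [e]splitr ltrD//.
  by rewrite distrC (lt_trans ui).
by rewrite distrC (lt_trans zi).
Qed.

Lemma measurable_of_dist_fun (f : X -> V) :
  (forall u, measurable_fun setT (fun x => `|f x - u|)) ->
  measurable_fun setT (f : X -> borelType V).
Proof.
move=> mf; apply: measurable_of_dist => u r.
have := mf u measurableT `]-oo, r[%classic (measurable_itv _).
by rewrite setTI (_ : _ @^-1` _ = [set x | `|f x - u| < r])//;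
  apply/seteqP; split => x /=; rewrite ?in_itv.
Qed.

Lemma measurable_distT (f : X -> V) (u : V) :
  measurable_fun setT (f : X -> borelType V) ->
  measurable_fun setT (fun x => `|f x - u|).
Proof. by move=> mf; exact: measurableT_comp (measurable_dist u) mf. Qed.

(** As g x is 1-Lipschitz, g x (f x) is at distance less than r from a exactly
when `|g x (u i) - a| + `|f x - u i| < r for some term u i of a dense sequence.
This countable union of measurable conditions replaces the joint measurability
of g, and in particular makes addition on V measurable. *)
Lemma measurable_caratheodory (g : X -> V -> V) (f : X -> V) :
  (forall v, measurable_fun setT (g^~ v : X -> borelType V)) ->
  (forall x v w, `|g x v - g x w| <= `|v - w|) ->
  measurable_fun setT (f : X -> borelType V) ->
  measurable_fun setT ((fun x => g x (f x)) : X -> borelType V).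
Proof.
move=> mg gL mf; apply: measurable_of_dist => a r.
have [u uP] := dense_sequence.
rewrite (_ : [set x | _] =
    \bigcup_i [set x | `|g x (u i) - a| + `|f x - u i| < r]).
  apply: bigcupT_measurable => i.
  have : measurable_fun setT (fun x => `|g x (u i) - a| + `|f x - u i|).
    by apply: measurable_funD; apply: measurable_distT.
  move=> /(_ measurableT `]-oo, r[%classic (measurable_itv _)).
  rewrite setTI (_ : _ @^-1` _ =
    [set x | `|g x (u i) - a| + `|f x - u i| < r])//.
apply/seteqP; split => [x /= h|x [i _ /=]]; last first.
  apply: le_lt_trans; rewrite -(subrKA (g x (u i))) addrC (le_trans (ler_normD _ _))//.
  by rewrite lerD2l.
have r0 : 0 < (r - `|g x (f x) - a|) / 2 by rewrite divr_gt0 ?subr_gt0.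
have [i ui] := uP (f x) _ r0; exists i => //=.
have h1 : `|g x (u i) - a| <= `|u i - f x| + `|g x (f x) - a|.
  rewrite -(subrKA (g x (f x))) (le_trans (ler_normD _ _))//.
  by rewrite lerD2r.
rewrite (distrC (f x)); lra.
Qed.

End separable_measurability.

(** * Comparing probability measures on thickenings of closed sets *)

Section thickening.
Context (R : realType) (V : completeNormedModType R).

Definition thickening (A : set V) (e : R) : set V :=
  [set x | exists2 y, A y & `|x - y| < e].

Lemma open_thickening A e : open (thickening A e).
Proof.
rewrite (_ : thickening A e = \bigcup_(y in A) ball y e).
  by apply: bigcup_open => y _; exact: ball_open.
apply/seteqP; split => x [y Ay] /= xy; exists y => //.
  by rewrite -ball_normE /= distrC.
by move: xy; rewrite -ball_normE /= distrC.
Qed.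

Lemma measurable_thickening A e :
  measurable (thickening A e : set (borelType V)).
Proof. by apply: open_borel; exact: open_thickening. Qed.

Lemma sub_thickening A e : 0 < e -> A `<=` thickening A e.
Proof. by move=> e0 x Ax; exists x => //; rewrite subrr normr0. Qed.

Lemma le_thickening A e f : e <= f -> thickening A e `<=` thickening A f.
Proof. by move=> ef x [y Ay xy]; exists y => //; exact: lt_le_trans ef. Qed.

Lemma thickening_thickening A e f :
  thickening (thickening A e) f `<=` thickening A (e + f).
Proof.
move=> x [y [z Az yz] xy]; exists z => //.
rewrite -(subrKA y) (le_lt_trans (ler_normD _ _))// addrC; exact: ltrD.
Qed.

Lemma bigcap_thickening A : closed A ->
  \bigcap_n thickening A n.+1%:R^-1 = A.
Proof.
move=> cA; apply/seteqP; split=> [x xA|x Ax n _]; last first.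
  by apply: sub_thickening => //; rewrite invr_gt0.
apply: cA => U /nbhs_ballP[e e0 eU].
have [n _ /(_ n (leqnn n)) h] := near_infty_natSinv_lt (PosNum e0).
have [y Ay xy] := xA n I; exists y; split => //; apply: eU.
by rewrite -ball_normE /= (lt_trans xy).
Qed.

Lemma cvg_thickening (m : probability (borelType V) R) (F : set V) :
  closed F -> m (thickening F n.+1%:R^-1) @[n --> \oo] --> m F.
Proof.
move=> cF; rewrite -[X in _ --> m X](bigcap_thickening cF).
apply: nonincreasing_cvg_mu.
- by rewrite (le_lt_trans (probability_le1 _ _)) ?ltry//; exact: measurable_thickening.
- by move=> n; exact: measurable_thickening.
- by apply: bigcap_measurable => // n _; exact: measurable_thickening.
- move=> n k nk; apply/subsetPset; apply: le_thickening.
  by rewrite lef_pV2 ?posrE// ler_nat ltnS.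
Qed.

Context (m1 m2 : probability (borelType V) R).

(** Complements turn the inequality on closed sets into the reverse one on open
sets, and the open thickenings of a closed set shrink to it. *)
Lemma eq_probability_closed_le :
  (forall F : set V, closed F -> (m1 F <= m2 F)%E) ->
  forall B, measurable B -> m1 B = m2 B.
Proof.
move=> m12.
have m12E (F : set V) : closed F -> m1 F = m2 F.
  move=> cF; apply/eqP; rewrite eq_le m12//=.
  apply: (@lee_cvg_to _ _ _ _ _ _ _ _ (cvg_thickening (m:=m2) cF) (cvg_thickening (m:=m1) cF)).
  apply: nearW => n.
  have mT := measurable_thickening F n.+1%:R^-1.
  have TC (m : probability (borelType V) R) :
      m (thickening F n.+1%:R^-1) = (1 - m (~` thickening F n.+1%:R^-1))%E.
    by rewrite -probability_setC ?setCK//; exact: measurableC.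
  rewrite !TC; apply: leeB => //; apply: m12; exact/open_closedC/open_thickening.
move=> B mB; apply: (@measure_unique _ _ (borelType V) (@open V) (fun=> setT)) => //.
- by move=> A B0; exact: openI.
- by move=> _; exact: openT.
- by rewrite bigcup_const.
- move=> A oA; have mA : measurable (A : set (borelType V)) by exact: open_borel.
  have AC (m : probability (borelType V) R) : m A = (1 - m (~` A))%E.
    by rewrite -probability_setC ?setCK//; exact: measurableC.
  apply: etrans (AC m1) (etrans _ (esym (AC m2))).
  by congr (1 - _)%E; apply: m12E; exact: open_closedC.
- by move=> _; rewrite (le_lt_trans (probability_le1 _ _)) ?ltry.
Qed.

(** The hypothesis is what a coupling provides: if two random variables are
within e of each other outside an event of probability at most dl, then their
laws satisfy it. *)
Lemma eq_probability_thickening :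
  (forall (F : set V) (e dl : R), closed F -> 0 < e -> 0 < dl ->
     (m1 F <= m2 (thickening F e) + dl%:E)%E) ->
  forall B, measurable B -> m1 B = m2 B.
Proof.
move=> m12; apply: eq_probability_closed_le => F cF.
apply/lee_addgt0Pr => dl dl0.
have h : m2 (thickening F n.+1%:R^-1) + dl%:E @[n --> \oo] --> (m2 F + dl%:E)%E.
  apply: cvgeD; [|exact: cvg_thickening|exact: cvg_cst].
  by rewrite fin_num_adde_defl.
apply: (cvge_to_ge h).
by apply: nearW => n; apply: m12 => //; rewrite invr_gt0.
Qed.

End thickening.

(** * Exponential waiting times *)

Section density.
Local Open Scope ereal_scope.
Context d (T : measurableType d) (R : realType).
Context (mu nu : {measure set T -> \bar R}) (p : T -> R).
Hypothesis p_ge0 : forall x, (0 <= p x)%R.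
Hypothesis p_meas : measurable_fun setT p.
Hypothesis nuE : forall A, measurable A -> nu A = \int[mu]_(x in A) (p x)%:E.

Import HBNNSimple.

Let integral_density_nnsfun (f : {nnsfun T >-> R}) :
  \int[nu]_x (f x)%:E = \int[mu]_x ((f x)%:E * (p x)%:E).
Proof.
under [LHS]eq_integral do rewrite fimfunE -fsumEFin//.
rewrite [LHS]ge0_integral_fsum//; last 2 first.
  - by move=> r; exact/measurable_EFinP/measurableT_comp.
  - by move=> n x _; rewrite EFinM nnfun_muleindic_ge0.
under [RHS]eq_integral.
  move=> x xD; rewrite fimfunE -fsumEFin// muleC ge0_mule_fsumr; last first.
    by move=> r; rewrite EFinM nnfun_muleindic_ge0.
  over.
have mpE : measurable_fun [set: T] (fun x => (p x)%:E) by exact/measurable_EFinP.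
rewrite [RHS]ge0_integral_fsum//; last 2 first.
  - move=> r; apply: emeasurable_funM => //.
    by apply/measurable_EFinP; apply/measurableT_comp.
  - move=> n x _; apply: mule_ge0; first by rewrite lee_fin.
    by rewrite EFinM nnfun_muleindic_ge0.
apply: eq_fsbigr => r /set_mem [x _ <-{r}].
set A := f @^-1` [set f x].
have mA : measurable A by exact: measurable_sfunP.
rewrite integralZl_indic_nnsfun//= integral_indic// setIT nuE//.
rewrite [in LHS]integral_mkcond -ge0_integralZl//.
- apply: eq_integral => y _; rewrite patchE indicE -/A.
  by case: ifPn => yA; rewrite ?mulr0 ?mule0// mulr1 muleC.
- by apply/(measurable_restrictT _ mA)/measurable_funTS.
- by move=> y _; apply: erestrict_ge0 => z _; rewrite lee_fin.
- by rewrite lee_fin.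
Qed.

Lemma ge0_integral_density (f : T -> \bar R) :
  measurable_fun setT f -> (forall x, 0 <= f x) ->
  \int[nu]_x f x = \int[mu]_x (f x * (p x)%:E).
Proof.
move=> mf f0; pose f_ := nnsfun_approx measurableT mf.
have mpE : measurable_fun [set: T] (fun x => (p x)%:E) by exact/measurable_EFinP.
transitivity (lim (\int[nu]_x (f_ n x)%:E @[n --> \oo])).
  rewrite -monotone_convergence//=.
  - apply: eq_integral => x _; apply/esym/cvg_lim => //=.
    exact: cvg_nnsfun_approx.
  - by move=> n; exact/measurable_EFinP/measurable_funTS.
  - by move=> n x _; rewrite lee_fin.
  - by move=> x _ m n mn; rewrite lee_fin; exact/lefP/nd_nnsfun_approx.
under eq_fun do rewrite integral_density_nnsfun.
rewrite -monotone_convergence//=.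
- apply: eq_integral => x _; apply/cvg_lim => //=.
  apply: cvgeZr => //; exact: cvg_nnsfun_approx.
- move=> n; apply: emeasurable_funM => //.
  by exact/measurable_EFinP/measurable_funTS.
- by move=> n x _; rewrite mule_ge0 ?lee_fin.
- move=> x _ m n mn; rewrite lee_wpmul2r ?lee_fin//.
  exact/lefP/nd_nnsfun_approx.
Qed.

End density.

Section lebesgue_affine.
Local Open Scope ereal_scope.
Context (R : realType).
Notation M := (measurableTypeR R).
Notation L := (@lebesgue_measure R).

Lemma ge0_integral_reflection (c : R) (f : M -> \bar R) :
  measurable_fun setT f -> (forall x, 0 <= f x) ->
  \int[L]_x f (c - x)%R = \int[L]_x f x.
Proof.
move=> mf f0; pose phi : M -> M := fun x : R => (c - x)%R.
have mphi : measurable_fun setT phi.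
  have : measurable_fun [set: R] (fun x : R => c - x)%R.
    by apply: measurable_funB => //; exact: measurable_cst.
  exact.
have -> : \int[L]_x f (c - x)%R = \int[pushforward L phi]_x f x.
  by rewrite (ge0_integral_pushforward mphi)// preimage_setT.
have [nu nuE] : exists nu : {measure set M -> \bar R},
    nu = pushforward L phi :> (set M -> \bar R).
  by unshelve eexists (pushforward L phi : {measure set M -> \bar R}).
rewrite -nuE; apply: (@eq_measure_integral _ M R setT _ nu) => A mA _; apply/esym.
apply: (@lebesgue_measure_unique _ nu) => //= _ [[a b]] _ <-.
rewrite nuE /pushforward (_ : _ @^-1` _ = `[(c - b)%R, (c - a)%R[%classic).
  rewrite !lebesgue_measure_itv/= !lte_fin ltrD2l ltrN2; case: ifP => // _.
  by rewrite -!EFinB; congr EFin; ring.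
apply/seteqP; split => x; rewrite /phi /= !in_itv /=.
  move=> /andP[h1 h2]; apply/andP; split; lra.
move=> /andP[h1 h2]; apply/andP; split; lra.
Qed.


Lemma ge0_integral_translation (c : R) (f : M -> \bar R) :
  measurable_fun setT f -> (forall x, 0 <= f x) ->
  \int[L]_x f (x + c)%R = \int[L]_x f x.
Proof.
move=> mf f0; rewrite -(ge0_integral_reflection c mf f0).
have mg : measurable_fun [set: M] (fun x : M => f (c - x)%R).
  apply: measurableT_comp => //.
  have : measurable_fun [set: R] (fun x : R => c - x)%R.
    by apply: measurable_funB => //; exact: measurable_cst.
  exact.
rewrite -[RHS](ge0_integral_reflection 0 mg)//=.
by apply: eq_integral => x _; congr f; ring.
Qed.

End lebesgue_affine.

Section exponential.
Local Open Scope ereal_scope.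
Context (R : realType) (theta : R) (e : probability R R).
Notation M := (measurableTypeR R).
Notation L := (@lebesgue_measure R).
Hypothesis theta_gt0 : (0 < theta)%R.
Hypothesis eE : forall B, measurable B -> e B = exponential_prob theta B.

Lemma integral_exponential (f : R -> \bar R) :
  measurable_fun setT f -> (forall x, 0 <= f x) ->
  \int[e]_x f x = \int[L]_x (f x * (exponential_pdf theta x)%:E).
Proof.
move=> mf f0; pose phi : R -> M := idfun.
have mphi : measurable_fun setT phi by exact: measurable_id.
have [nu nuE] : exists nu : {measure set M -> \bar R},
    nu = pushforward e phi :> (set M -> \bar R).
  by unshelve eexists (pushforward e phi : {measure set M -> \bar R}).
rewrite -(@ge0_integral_density _ M R L nu)//.
- by rewrite nuE (ge0_integral_pushforward mphi).
- by move=> x; rewrite exponential_pdf_ge0 // ltW.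
- exact: measurable_exponential_pdf.
- by move=> A mA; rewrite nuE /pushforward eE.
Qed.

Let pdfE (x : R) : exponential_pdf theta x =
  (if 0 <= x then theta * expR (- theta * x) else 0)%R.
Proof.
case: ifPn => [/exponential_pdfE->//|]; rewrite -ltNge => x0.
by rewrite lt0_exponential_pdf.
Qed.

Let pdf_ge0 (x : R) : (0 <= exponential_pdf theta x)%R.
Proof. by rewrite exponential_pdf_ge0// ltW. Qed.

Let mpdf : measurable_fun [set: M] (fun x => (exponential_pdf theta x)%:E).
Proof. by apply/measurable_EFinP; exact: measurable_exponential_pdf. Qed.

Lemma eq_exponential_ge0 (f g : R -> \bar R) :
  measurable_fun setT f -> (forall x, 0 <= f x) ->
  measurable_fun setT g -> (forall x, 0 <= g x) ->
  (forall b, (0 <= b)%R -> f b = g b) -> \int[e]_b f b = \int[e]_b g b.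
Proof.
move=> mf f0 mg g0 fg; rewrite !integral_exponential//.
apply: eq_integral => b _; rewrite pdfE.
by case: ifPn => [/fg->//|_]; rewrite !mule0.
Qed.

(** Absence of memory: beyond t, the law is its own translate by t, scaled by
the probability of exceeding t. *)
Lemma exponential_shift (t : R) (g : R -> \bar R) : (0 <= t)%R ->
  measurable_fun setT g -> (forall x, 0 <= g x) ->
  \int[e]_b ((t < b)%R%:R%:E * g b) = (expR (- theta * t))%:E * \int[e]_b g (b + t)%R.
Proof.
move=> t0 mg g0.
have mgM : @measurable_fun _ _ M _ setT g by [].
have mgt : measurable_fun setT (fun b : R => g (b + t)%R).
  apply: measurableT_comp => //.
  by apply: measurable_funD => //; exact: measurable_cst.
have mlt : measurable_fun setT (fun b : R => ((t < b)%R%:R : R)%:E).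
  by apply/measurable_EFinP; apply: measurableT_comp => //; exact: measurable_fun_ltr.
rewrite !integral_exponential//; last 2 first.
- exact: emeasurable_funM.
- by move=> b; rewrite mule_ge0.
have mk : measurable_fun [set: M] (fun b : M => g b * (exponential_pdf theta b)%:E).
  exact: emeasurable_funM.
rewrite -ge0_integralZl//; last 2 first.
- have mgtM : measurable_fun [set: M] (fun b : M => g (b + t)%R) by [].
  exact: emeasurable_funM mgtM mpdf.
- by move=> b _; rewrite mule_ge0// lee_fin.
pose psi (b : M) := (expR (- theta * t))%:E * (g b * (exponential_pdf theta (b - t)%R)%:E).
rewrite [RHS](_ : _ = \int[L]_b psi (b + t)%R); last first.
  by apply: eq_integral => b _; rewrite /psi addrK.
have mpsi : measurable_fun [set: M] psi.
  apply: emeasurable_funM => //; apply: emeasurable_funM => //.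
  apply: measurableT_comp mpdf _.
  have : measurable_fun [set: R] (fun b : R => (b - t)%R).
    by apply: measurable_funB => //; exact: measurable_cst.
  exact.
rewrite ge0_integral_translation//; last first.
  by move=> x; rewrite /psi !mule_ge0// ?lee_fin ?expR_ge0.
transitivity (\int[L]_(b in `]t, +oo[) (g b * (exponential_pdf theta b)%:E)).
  rewrite [RHS]integral_mkcond; apply: eq_integral => b _.
  rewrite patchE; case: ifPn.
    by rewrite inE /= in_itv /= andbT => ->; rewrite mul1e.
  by rewrite notin_setE /= in_itv /= andbT => /negP/negbTE->; rewrite !mul0e.
(* The translated density charges the closed half-line; a point is null. *)
rewrite integral_itv_obnd_cbnd; last exact: measurable_funTS.
rewrite integral_mkcond; apply: eq_integral => b _.
rewrite patchE /psi !pdfE; case: ifPn.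
  rewrite inE /= in_itv /= andbT => tb.
  rewrite (le_trans t0 tb) subr_ge0 tb muleCA; congr (_ * _).
  rewrite -EFinM; congr EFin; rewrite mulrCA -expRD; congr (_ * expR _)%R; ring.
rewrite notin_setE /= in_itv /= andbT => /negP/negbTE tb.
by rewrite subr_ge0 tb !mule0.
Qed.

Lemma exponential_tail (t : R) : (0 <= t)%R ->
  e `]t, +oo[%classic = (expR (- theta * t))%:E.
Proof.
move=> t0; have := @exponential_shift t (cst 1) t0 (measurable_cst _) ltac:(by []).
rewrite [X in _ * X](_ : _ = 1) ?mule1; last first.
  by rewrite integral_cst// mul1e; exact: probability_setT.
move=> <-; rewrite -[e _]mul1e -integral_cst// integral_mkcond; apply: eq_integral => b _.
rewrite patchE; case: ifPn.
  by rewrite inE /= in_itv /= andbT => ->; rewrite mul1e.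
by rewrite notin_setE /= in_itv /= andbT => /negP/negbTE->; rewrite mul0e.
Qed.

(** The product of the density at b with the probability that the next gap
exceeds u - b is the constant theta * expR (- theta * u) on [0, u].  It is
symmetric under b |-> u - b: given that exactly one jump falls into a window,
the jump can be counted from either end of the window. *)
Lemma exponential_reflection (u : R) (g : R -> \bar R) :
  measurable_fun setT g -> (forall x, 0 <= g x) ->
  \int[e]_b ((b <= u)%R%:R%:E * (expR (- theta * (u - b)))%:E * g b) =
  \int[e]_b ((b <= u)%R%:R%:E * (expR (- theta * (u - b)))%:E * g (u - b)%R).
Proof.
move=> mg g0.
have msub : measurable_fun setT (fun b : R => u - b)%R.
  by apply: measurable_funB => //; exact: measurable_cst.
have mgu : measurable_fun setT (fun b : R => g (u - b)%R) by exact: measurableT_comp.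
have mw : measurable_fun setT (fun b : R =>
    ((b <= u)%R%:R : R)%:E * (expR (- theta * (u - b)))%:E).
  apply: emeasurable_funM; apply/measurable_EFinP; apply: measurableT_comp => //.
    exact: measurable_fun_ler.
  by apply: measurable_funM => //; exact: measurable_cst.
have w0 b : 0 <= ((b <= u)%R%:R : R)%:E * (expR (- theta * (u - b)))%:E.
  by rewrite mule_ge0 ?lee_fin ?expR_ge0.
rewrite !integral_exponential//; last 4 first.
- exact: emeasurable_funM.
- by move=> b; rewrite mule_ge0.
- exact: emeasurable_funM.
- by move=> b; rewrite mule_ge0.
pose psi (b : M) := ((0 <= b) && (b <= u))%R%:R%:E * (theta * expR (- theta * u))%:E * g b.
have mpsi : measurable_fun [set: M] psi.
  have : measurable_fun [set: R] psi.
    apply: emeasurable_funM => //; apply: emeasurable_funM => //.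
    apply/measurable_EFinP; apply: measurableT_comp => //.
    by apply: measurable_and; apply: measurable_fun_ler => //; exact: measurable_cst.
  exact.
have psiE b (y : \bar R) : ((b <= u)%R%:R%:E * (expR (- theta * (u - b)))%:E * y
     * (exponential_pdf theta b)%:E =
   ((0 <= b) && (b <= u))%R%:R%:E * (theta * expR (- theta * u))%:E * y)%E.
  rewrite muleAC pdfE; congr (_ * _).
  case: (leP b u) => bu; rewrite ?andbF ?mul0e ?andbT//= mul1e.
  case: (leP 0%R b) => b0; rewrite ?mul0e ?mule0// mul1e -EFinM; congr EFin.
  rewrite mulrCA -expRD; congr (_ * expR _)%R; ring.
transitivity (\int[L]_b psi b); first by apply: eq_integral => b _; exact: psiE.
rewrite -(ge0_integral_reflection u mpsi); last first.
  by move=> x; rewrite /psi !mule_ge0// lee_fin mulr_ge0 ?expR_ge0// ltW.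
apply: eq_integral => b _; rewrite psiE /psi; congr (_%:R%:E * _ * _).
by rewrite subr_ge0 gerBl andbC.
Qed.

End exponential.

(** * Independence of one variable from all the others *)

Section independence.
Context d (Omega : measurableType d) (R : realType) (P : probability Omega R).
Context d1 (E1 : measurableType d1) d2 (E2 : measurableType d2).
Context (X : nat -> {RV P >-> E1}) (Y : nat -> {RV P >-> E2}) (m : nat).
Hypothesis X_ind : mutually_independent X.
Hypothesis XY_ind : independent_sequences X Y.

(** Generators of the sigma-algebra carried by all variables except X m. *)
Definition other_events : set (set Omega) :=
  [set A | (exists j B, [/\ j != m, measurable B & A = X j @^-1` B]) \/
           (exists j B, measurable B /\ A = Y j @^-1` B)].

(** Finitely many constraints on variables other than X m, presented with
constraint setT outside the finite set J so that the family is visibly closed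
under intersection. *)
Let cylinder : set (set Omega) := [set A | exists (J : {fset nat}) B1 B2,
  [/\ forall j, measurable (B1 j), forall j, measurable (B2 j),
      B1 m = setT, (forall j, j \notin J -> B1 j = setT /\ B2 j = setT) &
      A = \bigcap_j ((X j @^-1` B1 j) `&` (Y j @^-1` B2 j))]].

Let cylinderI : setI_closed cylinder.
Proof.
move=> _ _ [J [B1 [B2 [mB1 mB2 B1m BJ ->]]]] [K [C1 [C2 [mC1 mC2 C1m CK ->]]]].
exists (J `|` K)%fset, (fun j => B1 j `&` C1 j), (fun j => B2 j `&` C2 j); split.
- by move=> j; exact: measurableI.
- by move=> j; exact: measurableI.
- by rewrite B1m C1m setIT.
- move=> j; rewrite inE negb_or => /andP[/BJ[-> ->] /CK[-> ->]].
  by rewrite !setIT.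
- rewrite -bigcapI; apply: eq_bigcapr => j _.
  by rewrite !preimage_setI setIACA.
Qed.

Let sigma_X j B : measurable B -> sigma_of_sequence X (X j @^-1` B).
Proof. by move=> mB; apply: sub_sigma_algebra; exists j, B. Qed.

Let sigma_Y j B : measurable B -> sigma_of_sequence Y (Y j @^-1` B).
Proof. by move=> mB; apply: sub_sigma_algebra; exists j, B. Qed.

Let sigma_bigcap (G : set (set Omega)) (J : {fset nat}) (F : nat -> set Omega) :
  (forall j, <<s G >> (F j)) -> <<s G >> (\bigcap_(j in [set` J]) F j).
Proof.
move=> GF; pose T := g_sigma_algebraType G.
have : forall j, @measurable _ T (F j) by [].
by move=> mF; have : @measurable _ T (\bigcap_(j in [set` J]) F j)
  by apply: bigcap_measurableType => j _.
Qed.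

Let cylinder_ind A0 D : cylinder A0 -> measurable D ->
  P (A0 `&` X m @^-1` D) = (P A0 * P (X m @^-1` D))%E.
Proof.
move=> [J [B1 [B2 [mB1 mB2 B1m BJ ->]]]].
set A := \bigcap_j _.
pose c := ((\prod_(j <- (J `\ m)%fset) P (X j @^-1` B1 j)) *
           P (\bigcap_(j in [set` J]) (Y j @^-1` B2 j)))%E.
suff AD C : measurable C -> P (A `&` X m @^-1` C) = (P (X m @^-1` C) * c)%E.
  move=> mD; rewrite AD// muleC; congr (_ * _)%E.
  by have := AD setT measurableT; rewrite preimage_setT setIT probability_setT mul1e.
move=> mC; pose B j := if j == m then C else B1 j.
have mB j : measurable (B j) by rewrite /B; case: ifP.
rewrite (_ : _ `&` _ = (\bigcap_(j in [set` (m |` J)%fset]) (X j @^-1` B j)) `&`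
    (\bigcap_(j in [set` J]) (Y j @^-1` B2 j))); last first.
  rewrite /A; apply/seteqP; split => w [].
    move=> Aw Cw; split => j /= jJ; last by have [] := Aw j I.
    by rewrite /B; case: eqP => [->//|_]; have [] := Aw j I.
  move=> Xw Yw; split; last by have := Xw m; rewrite /B eqxx; apply; rewrite /= !inE eqxx.
  move=> j _; have [jJ|/BJ[-> ->]//] := boolP (j \in J); split; last exact: Yw.
  have := Xw j; rewrite /= !inE jJ orbT /B => /(_ isT).
  by case: eqP => [->|//]; rewrite B1m.
rewrite XY_ind; last 2 first.
- by apply: sigma_bigcap => j; exact: sigma_X.
- by apply: sigma_bigcap => j; exact: sigma_Y.
rewrite X_ind//= (big_fsetD1 m) ?inE ?eqxx//= {1}/B eqxx -muleA; congr (_ * (_ * _))%E.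
rewrite (_ : ((m |` J) `\ m)%fset = (J `\ m)%fset); last first.
  by apply/fsetP => j; rewrite !inE; case: eqP.
rewrite [LHS]big_seq [RHS]big_seq; apply: eq_bigr => j.
by rewrite !inE /B => /andP[/negbTE-> _].
Qed.

Let cylinder_measurable A : cylinder A -> measurable A.
Proof.
move=> [J [B1 [B2 [mB1 mB2 _ _ ->]]]]; apply: bigcap_measurable => // j _.
by apply: measurableI; rewrite -[_ @^-1` _]setTI; exact: measurable_funPT.
Qed.

Let other_events_cylinder : other_events `<=` cylinder.
Proof.
move=> _ [[i [B [im mB ->]]]|[i [B [mB ->]]]].
- exists [fset i]%fset, (fun j => if j == i then B else setT), (fun=> setT); split => //.
  + by move=> j; case: ifP.
  + by rewrite eq_sym (negbTE im).
  + by move=> j; rewrite inE => /negbTE ->.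
  + apply/seteqP; split => w.
      by move=> Bw j _; split => //=; case: eqP => // ->.
    by move=> /(_ i I)[]; rewrite /= eqxx.
- exists [fset i]%fset, (fun=> setT), (fun j => if j == i then B else setT); split => //.
  + by move=> j; case: ifP.
  + by move=> j; rewrite inE => /negbTE ->.
  + apply/seteqP; split => w.
      by move=> Bw j _; split => //=; case: eqP => // ->.
    by move=> /(_ i I)[]; rewrite /= eqxx.
Qed.

Let mX D : measurable D -> measurable (X m @^-1` D).
Proof. by move=> mD; rewrite -[_ @^-1` _]setTI; exact: measurable_funPT. Qed.

Lemma other_events_measurable A : <<s other_events >> A -> measurable A.
Proof.
apply: smallest_sub; first exact: sigma_algebra_measurable.
by move=> B /other_events_cylinder; exact: cylinder_measurable.
Qed.

(** On cylinders this is the product rule; both sides are finite measures in A,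
so the rule extends to the generated sigma-algebra. *)
Lemma other_events_independent A D : <<s other_events >> A -> measurable D ->
  P (A `&` X m @^-1` D) = (P A * P (X m @^-1` D))%E.
Proof.
move=> sA mD; have mXD := mX mD.
have sAc : <<s cylinder >> A.
  move: A sA; apply: smallest_sub; first exact: smallest_sigma_algebra.
  by move=> B /other_events_cylinder; exact: sub_sigma_algebra.
have r0 : 0 <= fine (P (X m @^-1` D)) by exact: fine_ge0.
have cE B : (mscale (NngNum r0) P B = P B * P (X m @^-1` D))%E.
  by rewrite /mscale/= fineK ?fin_num_measure// muleC.
rewrite -cE; apply: (@g_sigma_algebra_measure_unique _ _ _ cylinder _
  (fun=> setT) _ _ (mrestr P mXD) (mscale (NngNum r0) P) cylinderI) => //.
- move=> _; exists fset0, (fun=> setT), (fun=> setT); split => //.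
  by apply/seteqP; split.
- by rewrite bigcup_const.
- by move=> B cB; rewrite [RHS]cE -cylinder_ind.
- move=> _; change (P (setT `&` X m @^-1` D) < +oo)%E.
  by rewrite setTI ltey_eq fin_num_measure.
Qed.

(** Omega with the smaller sigma-algebra.  Measurability of G as a map on this
type says that G is a function of the variables other than X m, and is proved
by the general measurability lemmas. *)
Definition omega_but : measurableType _ := g_sigma_algebraType other_events.

Context d' (S : measurableType d').

Lemma measurable_omega_but (G : Omega -> S) :
  measurable_fun [set: omega_but] (G : omega_but -> S) -> measurable_fun setT G.
Proof.
move=> mG _ B mB; rewrite setTI; apply: other_events_measurable.
by have := mG measurableT B mB; rewrite setTI.
Qed.

(** The variable X m can be integrated out first, with G frozen. *)
Lemma integral_independent (G : Omega -> S) (h : E1 * S -> \bar R) :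
  measurable_fun [set: omega_but] (G : omega_but -> S) ->
  measurable_fun setT h -> (forall z, 0 <= h z)%E ->
  (\int[P]_w h (X m w, G w) =
   \int[distribution P (X m)]_x \int[P]_w h (x, G w))%E.
Proof.
move=> mG' mh h0; have mG := measurable_omega_but mG'.
have mXG : measurable_fun setT (fun w => (X m w, G w)).
  by apply: measurable_fun_pair => //; exact: measurable_funPT.
pose Gm : {mfun Omega >-> S} := HB.pack G (isMeasurableFun.Build _ _ _ _ _ mG).
pose XG : {mfun Omega >-> (E1 * S)%type} :=
  HB.pack (fun w => (X m w, G w)) (isMeasurableFun.Build _ _ _ _ _ mXG).
have XGE : forall Z, measurable Z ->
    (distribution P (X m) \x distribution P Gm)%E Z = distribution P XG Z.
  apply: product_measure_unique => A B mA mB.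
  rewrite [RHS]muleC -other_events_independent//; last first.
    by have := mG' measurableT B mB; rewrite setTI.
  by congr (P _); apply/seteqP; split => w [? ?].
transitivity (\int[distribution P XG]_z h z)%E.
  by rewrite ge0_integral_distribution.
transitivity (\int[distribution P (X m) \x distribution P Gm]_z h z)%E.
  by apply: eq_measure_integral => A mA _; exact: esym (XGE _ mA).
rewrite fubini_tonelli1//; apply: eq_integral => x _.
rewrite /fubini_F ge0_integral_distribution//.
exact: measurableT_comp mh (pair1_measurable x).
Qed.

End independence.

(** * Iterating a contractive flow with kicks *)

Section measurable_operations.
Context (R : realType) (V : completeNormedModType R).
Hypothesis V_separable : separable_space V.
Context d (X : measurableType d).

Lemma measurable_vadd (f g : X -> V) :
  measurable_fun setT (f : X -> borelType V) ->
  measurable_fun setT (g : X -> borelType V) ->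
  measurable_fun setT ((fun x => f x + g x) : X -> borelType V).
Proof.
move=> mf mg.
apply: (measurable_caratheodory V_separable (g := fun x v => f x + v)) => //.
- move=> v; apply: (measurable_caratheodory V_separable (g := fun x u => u + v)) => //.
  by move=> x u w; rewrite opprD addrACA subrr addr0.
- by move=> x v w; rewrite opprD addrACA subrr add0r.
Qed.

Lemma measurable_vcvg (f : nat -> X -> V) (g : X -> V) :
  (forall n, measurable_fun setT (f n : X -> borelType V)) ->
  (forall x, f n x @[n --> \oo] --> g x) ->
  measurable_fun setT (g : X -> borelType V).
Proof.
move=> mf fg; apply: (measurable_of_dist_fun V_separable) => u.
apply: (@measurable_fun_cvg _ _ _ _ (fun n x => `|f n x - u|)).
  by move=> n; exact: measurable_distT.
by move=> x _; apply: cvg_norm; apply: cvgB => //; exact: cvg_cst.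
Qed.

Lemma measurable_set_dist_ge (f g : X -> V) (r : R) :
  measurable_fun setT (f : X -> borelType V) ->
  measurable_fun setT (g : X -> borelType V) ->
  measurable [set x | r <= `|f x - g x|].
Proof.
move=> mf mg.
have mfg : measurable_fun setT ((fun x => f x - g x) : X -> borelType V).
  apply: (measurable_caratheodory V_separable (g := fun x v => f x - v)) => //.
  - move=> v; apply: (measurable_caratheodory V_separable (g := fun x u => u - v)) => //.
    by move=> x u w; rewrite opprD addrACA subrr addr0.
  - by move=> x v w; rewrite opprD opprK addrACA subrr add0r addrC distrC.
have := measurable_distT 0 mfg.
move=> /(_ measurableT `[r, +oo[%classic (measurable_itv _)).
rewrite setTI (_ : _ @^-1` _ = [set x | r <= `|f x - g x|])//.
by apply/seteqP; split => x /=; rewrite in_itv /= andbT subr0.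
Qed.

End measurable_operations.

Section close_laws.
Context (R : realType) (V : completeNormedModType R).
Hypothesis V_separable : separable_space V.
Context d (X : measurableType d) (P : probability X R).

(** If f x is in F and g x is closer than e to f x, then g x is in the
thickening. *)
Lemma close_laws (f g : X -> V) (F : set V) (e : R) :
  measurable (F : set (borelType V)) ->
  measurable_fun setT (f : X -> borelType V) ->
  measurable_fun setT (g : X -> borelType V) ->
  (P (f @^-1` F) <= P (g @^-1` thickening F e) + P [set x | (e <= `|f x - g x|)%R])%E.
Proof.
move=> mF mf mg.
have mgF : measurable (g @^-1` thickening F e).
  rewrite -[_ @^-1` _]setTI; apply: mg => //; exact: measurable_thickening.
have md := measurable_set_dist_ge V_separable e mf mg.
apply: (le_trans _ (measureU2 _ mgF md)); apply: le_measure; rewrite ?inE.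
- by rewrite -[_ @^-1` _]setTI; exact: mf.
- exact: measurableU.
- move=> x /= Ffx; have [h|h] := leP e `|f x - g x|; first by right.
  by left; exists (f x) => //; rewrite distrC.
Qed.

End close_laws.

Section backward_iteration.
Context (R : realType) (V : completeNormedModType R).
Variable S : R -> V -> V.
Hypothesis S_lip : forall t v w, `|S t v - S t w| <= `|v - w|.

Section pointwise.
Context (X : Type) (b : nat -> X -> R) (y : nat -> X -> V).

(** The kicked flow applied with the indices in decreasing order: b m acts
last.  Longer compositions only refine the innermost argument, which is why
they converge path by path while the forward ones do not. *)
Fixpoint backward (m n : nat) (v : V) (x : X) : V :=
  if n is n'.+1 then S (b m x) (y m x + backward m.+1 n' v x) else v.

Lemma backward_add m n j v x :
  backward m (n + j) v x = backward m n (backward (m + n) j v x) x.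
Proof.
elim: n m => [|n ih] m /=; first by rewrite addn0.
by rewrite ih addSnnS.
Qed.

(** The steps before k are 1-Lipschitz and the image of V under step k is small,
whatever happens in the steps after it. *)
Lemma backward_coalesce m n k v v' x (e : R) : (m <= k < m + n)%N ->
  (forall u u', `|S (b k x) u - S (b k x) u'| <= e) ->
  `|backward m n v x - backward m n v' x| <= e.
Proof.
move=> + bk; elim: n m => [|n ih] m; first by rewrite addn0 leqNgt andNb.
case: (eqVneq m k) => [->//=|mk] /andP[le_mk kmn] /=.
apply: (le_trans (S_lip _ _ _)).
rewrite opprD addrACA subrr add0r; apply: ih.
by rewrite addSnnS kmn andbT ltn_neqAle mk.
Qed.

Hypothesis S_coalesce : forall e : R, 0 < e ->
  exists M, forall t, M <= t -> forall v w, `|S t v - S t w| <= e.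

Lemma cvg_backward x : (forall M, exists k, M <= b k x) ->
  cvgn (fun n => backward 0 n 0 x).
Proof.
move=> xb; apply/cauchy_cvgP/cauchy_exP => e e0.
have e2 : 0 < e / 2 by rewrite divr_gt0.
have [M SM] := S_coalesce e2; have [k Mk] := xb M.
exists (backward 0 k.+1 0 x); exists k.+1 => // n kn.
rewrite -ball_normE -(subnKC (kn : (k < n)%N)).
rewrite /preimage /mkset /ball_ backward_add; apply: (@le_lt_trans _ _ (e / 2)); last by rewrite ltr_pdivrMr// ltr_pMr// ltr1n.
by apply: (backward_coalesce (k := k)); [rewrite add0n leqnn | exact: SM].
Qed.

Lemma backward_lim_coalesce k n x z (e : R) : (k < n)%N ->
  backward 0 i 0 x @[i --> \oo] --> z ->
  (forall u u', `|S (b k x) u - S (b k x) u'| <= e) ->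
  `|backward 0 n 0 x - z| <= e.
Proof.
move=> kn bz bk.
have h : `|backward 0 n 0 x - backward 0 i 0 x| @[i --> \oo] --> `|backward 0 n 0 x - z|.
  by apply: cvg_norm; apply: cvgB => //; exact: cvg_cst.
rewrite -(cvg_lim _ h)//; apply: limr_le; first by apply/cvg_ex; eexists; exact: h.
exists n => // i ni; rewrite -(subnKC (ni : (n <= i)%N)) /preimage /mkset backward_add.
by apply: (backward_coalesce (k := k)).
Qed.

End pointwise.

Hypothesis V_separable : separable_space V.
Hypothesis S_meas : forall v, measurable_fun setT ((S^~ v) : R -> borelType V).

Lemma measurable_flow d (X : measurableType d) (f : X -> R) (g : X -> V) :
  measurable_fun setT f -> measurable_fun setT (g : X -> borelType V) ->
  measurable_fun setT ((fun x => S (f x) (g x)) : X -> borelType V).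
Proof.
move=> mf mg; apply: (measurable_caratheodory V_separable (g := fun x v => S (f x) v)) => //.
by move=> v; exact: measurableT_comp (S_meas v) mf.
Qed.

Lemma measurable_backward d (X : measurableType d) (b : nat -> X -> R)
    (y : nat -> X -> V) m n :
  (forall k, (m <= k)%N -> measurable_fun setT (b k)) ->
  (forall k, (m <= k)%N -> measurable_fun setT (y k : X -> borelType V)) ->
  measurable_fun setT (backward b y m n 0 : X -> borelType V).
Proof.
elim: n m => [|n ih] m mb my /=; first exact: measurable_cst.
apply: measurable_flow; first exact: mb.
apply: measurable_vadd => //; first exact: my.
by apply: ih => k mk; [apply: mb|apply: my]; exact: ltnW.
Qed.

End backward_iteration.

(** * Long gaps occur almost surely *)

Section omega_but.
Context d (Omega : measurableType d) (R : realType) (P : probability Omega R).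
Context d1 (E1 : measurableType d1) d2 (E2 : measurableType d2).
Context (X : nat -> {RV P >-> E1}) (Y : nat -> {RV P >-> E2}) (m : nat).

Lemma measurable_but_fst j : j != m ->
  measurable_fun [set: omega_but X Y m] (X j : omega_but X Y m -> E1).
Proof.
move=> jm _ B mB; rewrite setTI; apply: sub_sigma_algebra.
by left; exists j, B.
Qed.

Lemma measurable_but_snd j :
  measurable_fun [set: omega_but X Y m] (Y j : omega_but X Y m -> E2).
Proof.
move=> _ B mB; rewrite setTI; apply: sub_sigma_algebra.
by right; exists j, B.
Qed.

End omega_but.

Lemma independent_sequencesC d (Omega : measurableType d) (R : realType)
    (P : probability Omega R) d1 (E1 : measurableType d1) d2 (E2 : measurableType d2)
    (X : nat -> {RV P >-> E1}) (Y : nat -> {RV P >-> E2}) :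
  independent_sequences X Y -> independent_sequences Y X.
Proof. by move=> XY A B YA XB; rewrite setIC XY// muleC. Qed.

Section short_gaps.
Context d (Omega : measurableType d) (R : realType) (P : probability Omega R).
Context (beta : nat -> {RV P >-> R}) (theta : R).
Hypothesis theta_gt0 : 0 < theta.
Hypothesis beta_iid : iid beta.
Hypothesis beta_exp : forall k, exponentially_distributed theta (beta k).

Definition short_gaps (M : R) (n : nat) : set Omega :=
  [set w | forall k, (k < n)%N -> beta k w < M].

Lemma short_gapsS M n : short_gaps M n.+1 = short_gaps M n `&` beta n @^-1` `]-oo, M[.
Proof.
apply/seteqP; split => [w h|w [h1 h2] k].
  by split; [move=> k kn; apply: h; exact: ltnW | rewrite /= in_itv /=; exact: h].
rewrite ltnS leq_eqVlt => /predU1P[->|kn]; last exact: h1.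
by move: h2; rewrite /= in_itv.
Qed.

Lemma measurable_short_gaps M n : measurable (short_gaps M n).
Proof.
elim: n => [|n ih]; first by rewrite (_ : short_gaps M 0 = setT)//; apply/seteqP; split.
rewrite short_gapsS; apply: measurableI => //.
by rewrite -[_ @^-1` _]setTI; exact: measurable_funPT.
Qed.

Lemma probability_short_gaps M n :
  P (short_gaps M n) = ((fine (distribution P (beta 0%N) `]-oo, M[)) ^+ n)%:E.
Proof.
set q := distribution P (beta 0%N) `]-oo, M[.
pose J k := [fset j in iota 0 k]%fset.
have JE k j : (j \in J k) = (j < k)%N by rewrite !inE mem_iota add0n.
have JS k : J k.+1 = (k |` J k)%fset.
  by apply/fsetP => j; rewrite JE in_fset1U JE ltnS leq_eqVlt.
have -> : short_gaps M n = \bigcap_(j in [set` J n]) beta j @^-1` `]-oo, M[.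
  apply/seteqP; split => w /= h k; have := h k.
    by rewrite /= JE in_itv /=; apply.
  by move=> + kn; rewrite /= JE in_itv /=; exact.
rewrite beta_iid.1//.
have qE j : P (beta j @^-1` `]-oo, M[) = q.
  exact: beta_iid.2 j _ (measurable_itv _).
under eq_bigr do rewrite qE.
elim: n => [|n ih]; first by rewrite expr0 big1_fset// => j; rewrite JE.
rewrite JS big_fsetU1 ?ih ?exprS ?EFinM ?fineK ?fin_num_measure//.
by rewrite JE ltnn.
Qed.

Lemma distribution_lt1 M : distribution P (beta 0%N) `]-oo, M[%classic \is a fin_num /\
  fine (distribution P (beta 0%N) `]-oo, M[) < 1.
Proof.
set q := distribution P (beta 0%N) `]-oo, M[.
have qfin : q \is a fin_num by rewrite fin_num_measure.
split => //; rewrite -lte_fin fineK//.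
pose M' := Num.max 0 M; have M'0 : 0 <= M' by rewrite le_max lexx.
have : (q <= distribution P (beta 0%N) `]-oo, M'])%E.
  apply: le_measure; rewrite ?inE//.
  by move=> x /=; rewrite !in_itv /= => /ltW xM; rewrite le_max xM orbT.
move=> /le_lt_trans; apply.
rewrite -setCitvr probability_setC//.
rewrite (exponential_tail theta_gt0 (beta_exp 0%N))//.
by rewrite -EFinB lte_fin gtrBl expR_gt0.
Qed.

Lemma cvg_probability_short_gaps M : P (short_gaps M n) @[n --> \oo] --> 0%E.
Proof.
under eq_fun do rewrite probability_short_gaps.
have [_ q1] := distribution_lt1 M.
apply: cvg_EFin; first exact: nearW.
apply: cvg_expr; rewrite ger0_norm//; exact: fine_ge0.
Qed.

Definition unbounded_gaps : set Omega := \bigcap_i ~` \bigcap_n short_gaps i%:R n.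

Lemma measurable_unbounded_gaps : measurable unbounded_gaps.
Proof.
apply: bigcap_measurable => // i _; apply: measurableC.
by apply: bigcap_measurable => // n _; exact: measurable_short_gaps.
Qed.

Lemma probability_bigcap_short_gaps M : P (\bigcap_n short_gaps M n) = 0%E.
Proof.
apply/eqP; rewrite eq_le measure_ge0 andbT.
apply: (cvge_to_ge (cvg_probability_short_gaps M)); apply: nearW => n.
apply: le_measure; rewrite ?inE//; last by move=> w; exact.
  by apply: bigcap_measurable => // k _; exact: measurable_short_gaps.
exact: measurable_short_gaps.
Qed.

Lemma probability_unbounded_gapsC : P (~` unbounded_gaps) = 0%E.
Proof.
rewrite /unbounded_gaps setC_bigcap; apply: measure_negligible.
  apply: bigcupT_measurable => i; rewrite setCK.
  by apply: bigcap_measurable => // k _; exact: measurable_short_gaps.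
apply: negligible_bigcup => i; rewrite setCK; apply/negligibleP.
  by apply: bigcap_measurable => // k _; exact: measurable_short_gaps.
exact: probability_bigcap_short_gaps.
Qed.

Lemma unbounded_gapsP w M : unbounded_gaps w -> exists k, M <= beta k w.
Proof.
move=> /(_ (Num.bound `|M|) I) h; apply: contrapT => h'; apply: h => n _ k kn.
rewrite ltNge; apply/negP => h; apply: h'; exists k; apply: le_trans h.
by rewrite (le_trans (ler_norm _))// ltW// archi_boundP.
Qed.

End short_gaps.

(** * Tonelli for three factors *)

Section tonelli3.
Local Open Scope ereal_scope.
Context (R : realType).

Lemma product_probability d1 d2 (X1 : measurableType d1) (X2 : measurableType d2)
    (p1 : probability X1 R) (p2 : probability X2 R) :
  exists p12 : probability (X1 * X2)%type R, p12 = p1 \x p2 :> (set _ -> \bar R).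
Proof. by exists (p1 \x p2). Qed.

Context d1 d2 d3 (X1 : measurableType d1) (X2 : measurableType d2)
  (X3 : measurableType d3).
Context (p1 : probability X1 R) (p2 : probability X2 R) (p3 : probability X3 R).

(** The product measure of two factors is replaced by an abstract probability
measure so that it can be treated as a single factor. *)
Lemma tonelli_reverse (K : X1 * (X2 * X3) -> \bar R) :
  measurable_fun setT K -> (forall z, 0 <= K z) ->
  \int[p1]_x \int[p2]_y \int[p3]_z K (x, (y, z)) =
  \int[p3]_z \int[p2]_y \int[p1]_x K (x, (y, z)).
Proof.
move=> mK K0; have [p23 p23E] := product_probability p2 p3.
transitivity (\int[p1]_x \int[p23]_u K (x, u)).
  apply: eq_integral => x _; rewrite p23E (fubini_tonelli1 (fun u => K (x, u)))//.
  exact: measurableT_comp mK (pair1_measurable x).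
transitivity (\int[p23]_u \int[p1]_x K (x, u)).
  exact: (fubini_tonelli (m1 := p1) (m2 := p23) K mK K0).
pose G u := \int[p1]_x K (x, u).
have mG : measurable_fun setT G by exact: (measurable_fun_fubini_tonelli_G K mK K0).
have G0 u : 0 <= G u by apply: integral_ge0.
rewrite p23E; exact: (fubini_tonelli2 (m1 := p2) (m2 := p3) G mG G0).
Qed.

(** The same device for the product of a product measure with a third one. *)
Lemma tonelli_nested (K : (X1 * X2) * X3 -> \bar R) :
  measurable_fun setT K -> (forall z, 0 <= K z) ->
  \int[(p1 \x p2) \x p3]_z K z = \int[p1]_x \int[p2]_y \int[p3]_z K ((x, y), z).
Proof.
move=> mK K0; have [p12 p12E] := product_probability p1 p2.
rewrite -p12E; transitivity (\int[p12]_u fubini_F p3 K u).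
  exact: (fubini_tonelli1 (m1 := p12) (m2 := p3) K mK K0).
have mF : measurable_fun setT (fubini_F p3 K).
  exact: (measurable_fun_fubini_tonelli_F K mK K0).
have F0 u : 0 <= fubini_F p3 K u by apply: integral_ge0.
rewrite p12E; exact: (fubini_tonelli1 (m1 := p1) (m2 := p2) (fubini_F p3 K) mF F0).
Qed.

End tonelli3.

(** * The law of the backward limit *)

Lemma cvge0_near_le (R : realType) (u : nat -> \bar R) (r : R) : 0 < r ->
  u n @[n --> \oo] --> 0%E -> \forall n \near \oo, (u n <= r%:E)%E.
Proof.
move=> r0 /fine_cvgP[ufin /cvgrPdist_le/(_ _ r0) ur].
near=> n; have ufn : u n \is a fin_num by near: n.
rewrite -(fineK ufn) lee_fin (le_trans (ler_norm _))//.
by rewrite -normrN -[- _]add0r; near: n.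
Unshelve. all: by end_near. Qed.

Section embedded_law.
Context d (Omega : measurableType d) (R : realType) (P : probability Omega R).
Context (V : completeNormedModType R).
Hypothesis V_separable : separable_space V.
Variable S : R -> V -> V.
Hypothesis S_lip : forall t v w, `|S t v - S t w| <= `|v - w|.
Hypothesis S_coalesce : forall e : R, 0 < e ->
  exists M, forall t, M <= t -> forall v w, `|S t v - S t w| <= e.
Hypothesis S_meas : forall v, measurable_fun setT ((S^~ v) : R -> borelType V).
Context (eta : nat -> {RV P >-> borelType V}) (beta : nat -> {RV P >-> R}).
Hypothesis eta_iid : iid eta.
Hypothesis beta_iid : iid beta.
Context (theta : R).
Hypothesis theta_gt0 : 0 < theta.
Hypothesis beta_exp : forall k, exponentially_distributed theta (beta k).
Hypothesis eta_beta : independent_sequences eta beta.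

Local Notation e := (distribution P (beta 0%N)).
Local Notation lam := (distribution P (eta 0%N)).
Local Notation Y m n := (backward S (fun k w => beta k w) (fun k w => (eta k w : V)) m n 0%R).

Local Notation kick b y z := (S b ((y : V) + (z : V))%R).

Lemma measurable_iterate m n : measurable_fun setT ((Y m n) : Omega -> borelType V).
Proof.
by apply: measurable_backward => // k _; exact: measurable_funPT.
Qed.

Lemma measurable_kick d' (X : measurableType d') (b : X -> R) (y z : X -> V) :
  measurable_fun setT b -> measurable_fun setT (y : X -> borelType V) ->
  measurable_fun setT (z : X -> borelType V) ->
  measurable_fun setT ((fun x => S (b x) (y x + z x)) : X -> borelType V).
Proof.
by move=> mb my mz; apply: measurable_flow => //; exact: measurable_vadd.
Qed.

Lemma integral_iid d' (E : measurableType d') (X : nat -> {RV P >-> E}) m (f : E -> \bar R) :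
  iid X -> (\int[distribution P (X m)]_x f x = \int[distribution P (X 0%N)]_x f x)%E.
Proof.
by move=> Xiid; apply: eq_measure_integral => A mA _; exact: Xiid.2.
Qed.

(** The gap and the jump with index m act last and are independent of the rest of
the composition, which only involves larger indices. *)
Lemma integral_iterateS m n (f : borelType V -> \bar R) :
  measurable_fun setT f -> (forall v, 0 <= f v)%E ->
  (\int[P]_w f (Y m n.+1 w) =
   \int[e]_b \int[lam]_y \int[P]_w f (kick b y (Y m.+1 n w)))%E.
Proof.
move=> mf f0.
pose G w : borelType V * borelType V := (eta m w, Y m.+1 n w).
pose h (z : R * (borelType V * borelType V)) : \bar R :=
  f (kick z.1 z.2.1 z.2.2).
have mh : measurable_fun setT h.
  apply: (measurableT_comp mf); apply: measurable_kick => //.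
  - exact: measurableT_comp measurable_fst measurable_snd.
  - exact: measurableT_comp measurable_snd measurable_snd.
have beta_eta := independent_sequencesC eta_beta.
have mG : measurable_fun [set: omega_but beta eta m] (G : omega_but beta eta m -> _).
  apply: measurable_fun_pair; first exact: measurable_but_snd.
  apply: measurable_backward => // k mk; last exact: measurable_but_snd.
  by apply: measurable_but_fst; rewrite neq_ltn mk orbT.
rewrite -[LHS]/(\int[P]_w h (beta m w, G w))%E.
rewrite (integral_independent beta_iid.1 beta_eta mG mh); last by move=> z; exact: f0.
apply: etrans (integral_iid _ _ beta_iid) _.
apply: eq_integral => b _.
pose h' (z : borelType V * borelType V) : \bar R := f (kick b z.1 z.2).
have mh' : measurable_fun setT h'.
  by apply: (measurableT_comp mf); apply: measurable_kick => //; exact: measurable_cst.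
have mY : measurable_fun [set: omega_but eta beta m]
    ((Y m.+1 n) : omega_but eta beta m -> borelType V).
  apply: measurable_backward => // k mk; first exact: measurable_but_snd.
  by apply: measurable_but_fst; rewrite neq_ltn mk orbT.
rewrite -[LHS]/(\int[P]_w h' (eta m w, Y m.+1 n w))%E.
rewrite (integral_independent eta_iid.1 eta_beta mY mh'); last by move=> z; exact: f0.
exact: integral_iid eta_iid.
Qed.

(** The gaps and jumps are identically distributed, so the first index is
immaterial. *)
Lemma integral_iterate_shift m n (f : borelType V -> \bar R) :
  measurable_fun setT f -> (forall v, 0 <= f v)%E ->
  (\int[P]_w f (Y m n w) = \int[P]_w f (Y 0 n w))%E.
Proof.
suff H m' : measurable_fun setT f -> (forall v, 0 <= f v)%E ->
  (\int[P]_w f (Y m n w) = \int[P]_w f (Y m' n w))%E by exact: H.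
elim: n m m' f => [//|n ih] m m' f mf f0.
rewrite (integral_iterateS m n mf f0) (integral_iterateS m' n mf f0); apply: eq_integral => b _; apply: eq_integral => y _.
apply: (ih _ _ (fun z => f (kick b y z))) => //.
by apply: (measurableT_comp mf); apply: measurable_kick => //; exact: measurable_cst.
Qed.

(** Combining the two facts above, one more backward step acts on laws as one
kick with fresh variables. *)
Lemma integral_iterate_step n (f : borelType V -> \bar R) :
  measurable_fun setT f -> (forall v, 0 <= f v)%E ->
  (\int[P]_w f (Y 0 n.+1 w) =
   \int[e]_b \int[lam]_y \int[P]_w f (kick b y (Y 0 n w)))%E.
Proof.
move=> mf f0; rewrite (integral_iterateS 0 n mf f0).
apply: eq_integral => b _; apply: eq_integral => y _.
apply: (integral_iterate_shift _ _ (f := (fun z => f (kick b y z)))) => //.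
by apply: (measurableT_comp mf); apply: measurable_kick => //; exact: measurable_cst.
Qed.

(** The value 0 off the almost sure event makes this map measurable. *)
Definition limit_state (w : Omega) : V :=
  if w \in unbounded_gaps beta then limn (fun n => Y 0 n w) else 0.

Lemma cvg_limit_state w : unbounded_gaps beta w -> Y 0 n w @[n --> \oo] --> limit_state w.
Proof.
move=> rw; rewrite /limit_state mem_set//.
by apply: cvg_backward => // M; exact: unbounded_gapsP.
Qed.

Lemma measurable_limit_state : measurable_fun setT (limit_state : Omega -> borelType V).
Proof.
apply: (measurable_vcvg V_separable
  (f := fun n w => if w \in unbounded_gaps beta then Y 0 n w else 0)).
- move=> n; apply: measurable_fun_ifT => //; last exact: measurable_iterate.
  apply: (measurable_fun_bool true); rewrite setTI.
  rewrite (_ : _ @^-1` _ = unbounded_gaps beta); first exact: measurable_unbounded_gaps.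
  by apply/seteqP; split => w; [move=> /set_mem | move=> h; exact: mem_set].
- move=> w; rewrite /limit_state; case: ifPn => [|_]; last exact: cvg_cst.
  by move=> /set_mem rw; apply: cvg_backward => // M; exact: unbounded_gapsP.
Qed.

Definition far_from_limit (n : nat) (r : R) : set Omega :=
  [set w | r <= `|limit_state w - Y 0 n w|].

Lemma measurable_far_from_limit n r : measurable (far_from_limit n r).
Proof.
apply: measurable_set_dist_ge => //; first exact: measurable_limit_state.
exact: measurable_iterate.
Qed.

(** Up to a null set, being far from the limit after n steps forces the first n
gaps to be short. *)
Lemma cvg_probability_far_from_limit r : 0 < r -> P (far_from_limit n r) @[n --> \oo] --> 0%E.
Proof.
move=> r0; have r2 : 0 < r / 2 by rewrite divr_gt0.
have [M SM] := S_coalesce r2.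
apply: (@squeeze_cvge _ _ _ _ (cst 0%E) _ (fun n => P (short_gaps beta M n))).
- apply: nearW => n; rewrite measure_ge0 /=.
  have mq := measurable_short_gaps beta M n.
  have mrC : measurable (~` unbounded_gaps beta) by apply: measurableC; exact: measurable_unbounded_gaps.
  rewrite -[leRHS]adde0 -(probability_unbounded_gapsC theta_gt0 beta_iid beta_exp).
  apply: (le_trans _ (measureU2 _ mq mrC)); apply: le_measure; rewrite ?inE.
  + exact: measurable_far_from_limit.
  + exact: measurableU.
  + move=> w /= farw; have [rw|] := pselect (unbounded_gaps beta w); last by right.
    left => k kn; rewrite ltNge; apply/negP => Mk.
    have := backward_lim_coalesce S_lip kn (cvg_limit_state rw) (SM _ Mk).
    rewrite distrC => /(le_trans farw); rewrite leNgt ltr_pdivrMr// ltr_pMr// ltr1n//.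
- exact: cvg_cst.
- exact: (cvg_probability_short_gaps theta_gt0 beta_iid beta_exp).
Qed.

Local Notation Q := ((e \x lam) \x P)%E.

Let law (g : Omega -> V) (mg : measurable_fun setT (g : Omega -> borelType V)) :
  {mfun Omega >-> borelType V} :=
  HB.pack (g : Omega -> borelType V) (isMeasurableFun.Build _ _ _ _ _ mg).

Definition kicked (g : Omega -> V) (z : (R * borelType V) * Omega) : borelType V :=
  kick z.1.1 z.1.2 (g z.2).

Lemma measurable_kicked (g : Omega -> V) :
  measurable_fun setT (g : Omega -> borelType V) -> measurable_fun setT (kicked g).
Proof.
move=> mg; apply: measurable_kick.
- exact: measurableT_comp measurable_fst measurable_fst.
- exact: measurableT_comp measurable_snd measurable_fst.
- exact: measurableT_comp mg measurable_snd.
Qed.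

Lemma integral_kicked (g : Omega -> V) (f : borelType V -> \bar R) :
  measurable_fun setT (g : Omega -> borelType V) ->
  measurable_fun setT f -> (forall v, 0 <= f v)%E ->
  (\int[Q]_z f (kicked g z) =
   \int[e]_b \int[lam]_y \int[P]_w f (kick b y (g w)))%E.
Proof.
move=> mg mf f0; have mfk := measurableT_comp mf (measurable_kicked mg).
have fk0 z : (0 <= (f \o kicked g) z)%E by exact: f0.
exact: (tonelli_nested e lam P mfk fk0).
Qed.

Lemma probability_kicked_iterate n (B : set (borelType V)) : measurable B ->
  Q (kicked (Y 0 n) @^-1` B) = P (Y 0 n.+1 @^-1` B).
Proof.
move=> mB.
have mi : measurable_fun setT (fun v : borelType V => (\1_B v)%:E : \bar R).
  by apply/measurable_EFinP; exact: measurable_indic.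
have i0 v : (0 <= (\1_B v)%:E :> \bar R)%E by rewrite lee_fin.
have := integral_iterate_step n mi i0.
rewrite -(integral_kicked (measurable_iterate 0 n) mi i0).
have mY : measurable (Y 0 n.+1 @^-1` B).
  by rewrite -[_ @^-1` _]setTI; exact: measurable_iterate.
have mk : measurable (kicked (Y 0 n) @^-1` B).
  rewrite -[_ @^-1` _]setTI; apply: measurable_kicked => //; exact: measurable_iterate.
have : (\int[P]_w (\1_(Y 0 n.+1 @^-1` B) w)%:E = P (Y 0 n.+1 @^-1` B))%E.
  by rewrite integral_indic// setIT.
have : (\int[Q]_w (\1_(kicked (Y 0 n) @^-1` B) w)%:E = Q (kicked (Y 0 n) @^-1` B))%E.
  by rewrite integral_indic// setIT.
by move=> <- <-.
Qed.

Definition stationary_law : probability (borelType V) R :=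
  distribution P (law measurable_limit_state).

(** The law of Y n tends to that of its limit and, kicks being 1-Lipschitz, so
does the law of the kicked Y n; but the latter is the law of Y n.+1.  Both
approximations cost r / 2 in distance and dl / 2 in probability. *)
Lemma stationary_law_kick (B : set (borelType V)) : measurable B ->
  Q (kicked limit_state @^-1` B) = stationary_law B.
Proof.
have mZ := measurable_limit_state; have mkZ := measurable_kicked mZ.
pose kZ : {mfun ((R * borelType V) * Omega)%type >-> borelType V} :=
  HB.pack (kicked limit_state) (isMeasurableFun.Build _ _ _ _ _ mkZ).
apply: (@eq_probability_thickening _ _ (distribution Q kZ) stationary_law).
move=> F r dl cF r0 dl0.
have r2 : 0 < r / 2 by rewrite divr_gt0.
have farE n : (Q [set z | (r / 2 <= `|kicked limit_state z - kicked (Y 0 n) z|)%R] <=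
   P (far_from_limit n (r / 2)))%E.
  rewrite -[leRHS]mul1e -(probability_setT (e \x lam)%E).
  rewrite -product_measure1E//; last exact: measurable_far_from_limit.
  apply: le_measure; rewrite ?inE.
  + apply: measurable_set_dist_ge => //; apply: measurable_kicked => //.
    exact: measurable_iterate.
  + by apply: measurableX => //; exact: measurable_far_from_limit.
  + move=> [[b y] w] /= h; split => //=; apply: le_trans h _; rewrite /kicked /=.
    by apply: le_trans (S_lip _ _ _) _; rewrite opprD addrACA subrr add0r.
have dl2 : 0 < dl / 2 by rewrite divr_gt0.
have [n [n1 n2]] : exists n, (P (far_from_limit n (r / 2)) <= (dl / 2)%:E)%E /\
    (P (far_from_limit n.+1 (r / 2)) <= (dl / 2)%:E)%E.
  have [N _ NP] := cvge0_near_le dl2 (cvg_probability_far_from_limit r2).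
  by exists N; split; apply: NP => /=.
have mT A s : measurable (thickening A s : set (borelType V)) by exact: measurable_thickening.
have h1 := @close_laws _ V V_separable _ _ Q _ _ F (r / 2) (closed_borel cF) mkZ
  (measurable_kicked (measurable_iterate 0 n)).
have h2 := @close_laws _ V V_separable _ _ P _ _ (thickening F (r / 2)) (r / 2) (mT _ _)
   (measurable_iterate 0 n.+1) mZ.
have h3 : (P (limit_state @^-1` thickening (thickening F (r / 2)) (r / 2)) <=
    stationary_law (thickening F r))%E.
  apply: le_measure; rewrite ?inE.
  - by rewrite -[_ @^-1` _]setTI; apply: mZ => //; exact: mT.
  - by rewrite -[_ @^-1` _]setTI; apply: mZ => //; exact: mT.
  - move=> w /=; rewrite [r in X in _ -> X]splitr; exact: thickening_thickening.
have h4 := probability_kicked_iterate n (mT F (r / 2)).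
apply: (le_trans h1); rewrite [dl]splitr EFinD [leRHS]addeA.
apply: leeD; last exact: le_trans (farE n) n1.
apply: (le_trans (y := P (Y 0 n.+1 @^-1` thickening F (r / 2)))).
  by rewrite -h4.
apply: (le_trans h2); apply: leeD h3 _.
apply: le_trans n2; apply: le_measure; rewrite ?inE.
- by apply: measurable_set_dist_ge => //; exact: measurable_iterate.
- exact: measurable_far_from_limit.
- by move=> w /=; rewrite distrC.
Qed.

Lemma stationary_law_fixpoint (f : borelType V -> \bar R) :
  measurable_fun setT f -> (forall v, 0 <= f v)%E ->
  (\int[stationary_law]_v f v =
   \int[e]_b \int[lam]_y \int[stationary_law]_z f (kick b y z))%E.
Proof.
move=> mf f0.
have mZ := measurable_limit_state; have mkZ := measurable_kicked mZ.
pose kZ : {mfun ((R * borelType V) * Omega)%type >-> borelType V} :=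
  HB.pack (kicked limit_state) (isMeasurableFun.Build _ _ _ _ _ mkZ).
transitivity (\int[distribution Q kZ]_v f v)%E.
  by apply: eq_measure_integral => A mA _; exact: esym (stationary_law_kick mA).
rewrite ge0_integral_distribution//.
rewrite (integral_kicked mZ mf f0); apply: eq_integral => b _; apply: eq_integral => y _.
rewrite (ge0_integral_distribution (law mZ) (f := fun z => f (kick b y z)))//.
by apply: (measurableT_comp mf); apply: measurable_kick => //; exact: measurable_cst.
Qed.


End embedded_law.

(** * Paths of the process between jumps *)

Section pieces.
Context d (Omega : measurableType d) (R : realType) (P : probability Omega R).
Context (V : completeNormedModType R) (T : R -> V -> V).
Context (eta : nat -> {RV P >-> borelType V}) (beta : nat -> {RV P >-> R}).
Hypothesis beta_gt0 : forall k w, 0 < beta k w.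

Lemma arrival0 w : arrival beta 0 w = 0.
Proof. by rewrite /arrival big_ord0. Qed.

Lemma arrivalS k w : arrival beta k.+1 w = arrival beta k w + beta k w.
Proof. by rewrite /arrival big_ord_recr. Qed.

Lemma le_arrival m n w : (m <= n)%N -> arrival beta m w <= arrival beta n w.
Proof.
move=> /subnKC <-; elim: (n - m)%N => [|k ih]; first by rewrite addn0.
by rewrite addnS arrivalS (le_trans ih)// lerDl ltW.
Qed.

Lemma arrival_ge0 n w : 0 <= arrival beta n w.
Proof. by rewrite -(arrival0 w) le_arrival. Qed.

Definition in_gap (t : R) (k : nat) (w : Omega) : bool :=
  arrival beta k w <= t < arrival beta k.+1 w.

Lemma in_gap_inj t j k w : in_gap t j w -> in_gap t k w -> j = k.
Proof.
wlog jk : j k / (j <= k)%N => [H aj ak|/andP[_ h1] /andP[h2 _]].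
  by case/orP: (leq_total j k) => h; [|symmetry]; apply: H.
move: jk; rewrite leq_eqVlt => /predU1P[//|jk].
by have := le_lt_trans (le_trans (le_arrival w jk) h2) h1; rewrite ltxx.
Qed.

Let term v t w m : V := (\1_(`[arrival beta m w, arrival beta m.+1 w[%classic) t : R) *:
      T (Num.max 0 (t - arrival beta m w)) (chain T eta beta v m w).

Let termE v t w m : term v t w m =
  if in_gap t m w then T (Num.max 0 (t - arrival beta m w)) (chain T eta beta v m w) else 0.
Proof.
rewrite /term indicE /in_gap.
case: ifPn => h; first by rewrite mem_set ?scale1r//= in_itv.
by rewrite memNset ?scale0r//= in_itv /=; exact/negP.
Qed.

Lemma process_in_gap v t w k : in_gap t k w ->
  process T eta beta v t w =
  T (Num.max 0 (t - arrival beta k w)) (chain T eta beta v k w).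
Proof.
move=> ak; apply: lim_near_cst => //; exists k.+1 => // n kn.
rewrite /series /= big_mkord (bigD1 (Ordinal (kn : (k < n)%N)))//= big1 ?addr0.
  by rewrite -/(term v t w k) termE ak.
move=> i ik; rewrite -/(term v t w i) termE; case: ifPn => // /in_gap_inj/(_ ak) ik'.
by move: ik; rewrite -val_eqE /= ik' eqxx.
Qed.

Lemma process_no_gap v t w : (forall k, ~~ in_gap t k w) -> process T eta beta v t w = 0.
Proof.
move=> nogap; apply: lim_near_cst => //; apply: nearW => n.
rewrite /series /= big1// => i _.
by rewrite -/(term v t w i) termE (negbTE (nogap i)).
Qed.

Lemma in_gap_exists t k w : 0 <= t -> t < arrival beta k w -> exists2 j, (j < k)%N & in_gap t j w.
Proof.
move=> t0; elim: k => [|k ih]; first by rewrite arrival0 ltNge t0.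
move=> tk; have [/ih[j jk aj]|kt] := ltP t (arrival beta k w).
  by exists j => //; exact: ltnW.
by exists k => //; rewrite /in_gap kt.
Qed.

End pieces.

(** * The process started from a fixed point of the kicked flow *)

Lemma integral_probability_cst d (X : measurableType d) (R : realType)
  (p : probability X R) (c : \bar R) : (\int[p]_x c = c)%E.
Proof.
have := integral_cst p (@measurableT _ X) c; rewrite /cst => ->.
by rewrite [X in (_ * X)%E](_ : _ = 1%E) ?mule1//; exact: probability_setT.
Qed.

Section forward_iteration.
Context (R : realType) (V : completeNormedModType R).
Hypothesis V_separable : separable_space V.
Variable S : R -> V -> V.
Hypothesis S_lip : forall t v w, `|S t v - S t w| <= `|v - w|.
Hypothesis S_meas : forall v, measurable_fun setT ((S^~ v) : R -> borelType V).
Context d (X : measurableType d) (b : nat -> X -> R) (y : nat -> X -> V).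

Fixpoint forward (v : V) (k : nat) (x : X) : V :=
  if k is k'.+1 then S (b k' x) (forward v k' x) + y k' x else v.

Lemma measurable_forward (v : X -> V) k :
  measurable_fun setT (v : X -> borelType V) ->
  (forall j, (j < k)%N -> measurable_fun setT (b j)) ->
  (forall j, (j < k)%N -> measurable_fun setT (y j : X -> borelType V)) ->
  measurable_fun setT ((fun x => forward (v x) k x) : X -> borelType V).
Proof.
move=> mv; elim: k => [//|k ih] mb my /=; apply: measurable_vadd => //; last exact: my.
apply: measurable_flow => //; first exact: mb.
by apply: ih => j jk; [apply: mb|apply: my]; exact: ltnW.
Qed.

Lemma measurable_partial_sum k :
  (forall j, (j < k)%N -> measurable_fun setT (b j)) ->
  measurable_fun setT (fun x => \sum_(j < k) b j x).
Proof.
elim: k => [|k ih] mb.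
  by under eq_fun do rewrite big_ord0; exact: measurable_cst.
under eq_fun do rewrite big_ord_recr.
apply: measurable_funD; last exact: mb.
by apply: ih => j jk; apply: mb; exact: ltnW.
Qed.

End forward_iteration.

Section invariance.
Context d (Omega : measurableType d) (R : realType) (P : probability Omega R).
Context (V : completeNormedModType R).
Hypothesis V_separable : separable_space V.
Variable S : R -> V -> V.
Hypothesis S_lip : forall t v w, `|S t v - S t w| <= `|v - w|.
Hypothesis S_meas : forall v, measurable_fun setT ((S^~ v) : R -> borelType V).
Hypothesis S_add : forall s t v, 0 <= s -> 0 <= t -> S (s + t) v = S s (S t v).
Context (eta : nat -> {RV P >-> borelType V}) (beta : nat -> {RV P >-> R}).
Hypothesis eta_iid : iid eta.
Hypothesis beta_iid : iid beta.
Hypothesis beta_gt0 : forall k w, 0 < beta k w.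
Context (theta : R).
Hypothesis theta_gt0 : 0 < theta.
Hypothesis beta_exp : forall k, exponentially_distributed theta (beta k).
Hypothesis eta_beta : independent_sequences eta beta.

Local Notation e := (distribution P (beta 0%N)).
Local Notation lam := (distribution P (eta 0%N)).
Local Notation kick b y z := (S b ((y : V) + (z : V))%R).
Local Notation A k := (arrival beta k).
Local Notation C k v := (forward S (fun j w => beta j w) (fun j w => (eta j w : V)) v k).

(** The probability that no jump occurs during (a, t], given a jump at time a,
and 0 if a exceeds t. *)
Definition survival_weight (t a : R) : \bar R :=
  (((a <= t)%R%:R : R)%:E * (expR (- theta * (t - a)))%:E)%E.

Lemma survival_weight_ge0 t a : (0 <= survival_weight t a)%E.
Proof. by rewrite /survival_weight mule_ge0 ?lee_fin ?expR_ge0. Qed.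

Lemma measurable_survival_weight d' (X : measurableType d') (t a : X -> R) :
  measurable_fun setT t -> measurable_fun setT a ->
  measurable_fun setT (fun x => survival_weight (t x) (a x)).
Proof.
move=> mt ma; apply: emeasurable_funM; apply/measurable_EFinP; apply: measurableT_comp => //.
  exact: measurable_fun_ler.
by apply: measurable_funM => //; exact: measurable_funB.
Qed.

(** The contribution of no further jump before t to the mean of f (X t), given
a jump at time a that leads to the state x. *)
Definition survival (t : R) (f : borelType V -> \bar R) (a : R) (x : V) : \bar R :=
  (survival_weight t a * f (S (t - a) x))%E.

Lemma survival_ge0 t f a x : (forall v, 0 <= f v)%E -> (0 <= survival t f a x)%E.
Proof. by move=> f0; rewrite mule_ge0// survival_weight_ge0. Qed.

Lemma measurable_survival d' (X : measurableType d') (f : borelType V -> \bar R) (t a : X -> R) (x : X -> V) :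
  measurable_fun setT f ->
  measurable_fun setT t -> measurable_fun setT a ->
  measurable_fun setT (x : X -> borelType V) ->
  measurable_fun setT (fun p => survival (t p) f (a p) (x p)).
Proof.
move=> mf mt ma mx; apply: emeasurable_funM; first exact: measurable_survival_weight.
apply: measurableT_comp mf _; apply: measurable_flow => //.
exact: measurable_funB.
Qed.

Lemma measurable_survival_kick d' (X : measurableType d') (f : borelType V -> \bar R) (t b a : X -> R) (y x : X -> V) :
  measurable_fun setT f ->
  measurable_fun setT t -> measurable_fun setT b -> measurable_fun setT a ->
  measurable_fun setT (x : X -> borelType V) ->
  measurable_fun setT (y : X -> borelType V) ->
  measurable_fun setT (fun p => survival (t p) (fun z => f (kick (b p) (y p) z)) (a p) (x p)).
Proof.
move=> mf mt mb ma mx my; apply: emeasurable_funM; first exact: measurable_survival_weight.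
apply: measurableT_comp mf _; apply: measurable_kick => //.
by apply: measurable_flow => //; exact: measurable_funB.
Qed.

Lemma measurable_arrival k : measurable_fun setT (A k).
Proof.
apply: (measurable_partial_sum (b := fun k w => beta k w)) => j _.
exact: (measurable_funPT (beta j)).
Qed.

Lemma measurable_state k :
  measurable_fun setT ((fun z => C k z.2 z.1) : Omega * borelType V -> borelType V).
Proof.
pose b k (z : Omega * borelType V) := beta k z.1.
pose y k (z : Omega * borelType V) : V := eta k z.1.
have CE : (fun z : Omega * borelType V => C k z.2 z.1) =
    (fun z => forward S b y (z.2 : V) k z).
  by apply/funext => z; elim: k => [//|j ih] /=; rewrite ih.
rewrite CE; apply: (measurable_forward V_separable S_lip S_meas (b := b) (y := y)
  (v := fun z : Omega * borelType V => z.2)).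
- exact: measurable_snd.
- by move=> j _; exact: (measurableT_comp (measurable_funPT (beta j)) measurable_fst).
- by move=> j _; exact: (measurableT_comp (measurable_funPT (eta j)) measurable_fst).
Qed.

(** Given the state x at the time a of jump k, the next gap b and the next jump y
lead to S (t - a - b) (S b x + y) at time t.  Reflecting b in the window
[0, t - a] exchanges the two flows: the last flow gets length b, and jump k
is followed up to time t - b only. *)
Lemma integral_survival_step v k t (f : borelType V -> \bar R) :
  measurable_fun setT f -> (forall z, 0 <= f z)%E ->
  (\int[P]_w survival t f (A k.+1 w) (C k.+1 v w) =
   \int[P]_w \int[lam]_y \int[e]_b
     survival (t - b)%R (fun z => f (kick b y z)) (A k w) (C k v w))%E.
Proof.
move=> mf f0.
have beta_eta := independent_sequencesC eta_beta.
pose D := (R * (borelType V * (R * borelType V)))%type.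
pose h1 (q : D) := survival t f (q.2.2.1 + q.1) (S q.1 (q.2.2.2 : V) + (q.2.1 : V)).
have m1 : measurable_fun setT (fun q : D => q.1) by exact: measurable_fst.
have m21 : measurable_fun setT (fun q : D => q.2.1).
  exact: measurableT_comp measurable_fst measurable_snd.
have m221 : measurable_fun setT (fun q : D => q.2.2.1).
  exact: measurableT_comp measurable_fst (measurableT_comp measurable_snd measurable_snd).
have m222 : measurable_fun setT (fun q : D => q.2.2.2).
  exact: measurableT_comp measurable_snd (measurableT_comp measurable_snd measurable_snd).
have mh1 : measurable_fun setT h1.
  apply: measurable_survival => //; first exact: measurable_funD.
  by apply: measurable_vadd => //; exact: measurable_flow.
have h10 q : (0 <= h1 q)%E by exact: survival_ge0.
pose O1 : measurableType _ := omega_but beta eta k.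
pose O2 : measurableType _ := omega_but eta beta k.
have mG1 : measurable_fun [set: O1]
    ((fun w => (eta k w, (A k w, C k v w))) : O1 -> (borelType V * (R * borelType V))%type).
  apply: measurable_fun_pair; first exact: measurable_but_snd.
  apply: measurable_fun_pair.
    apply: (measurable_partial_sum (X := O1) (b := fun k w => beta k w)) => j jk.
    by apply: measurable_but_fst; rewrite neq_ltn jk.
  apply: (measurable_forward V_separable S_lip S_meas (X := O1)
    (b := fun k w => beta k w) (y := fun k w => eta k w) (v := fun=> v)) => // j jk.
    by apply: measurable_but_fst; rewrite neq_ltn jk.
  exact: measurable_but_snd.
have mG2 : measurable_fun [set: O2]
    ((fun w => (A k w, C k v w)) : O2 -> (R * borelType V)%type).
  apply: measurable_fun_pair.
    apply: (measurable_partial_sum (X := O2) (b := fun k w => beta k w)) => j jk.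
    exact: measurable_but_snd.
  apply: (measurable_forward V_separable S_lip S_meas (X := O2)
    (b := fun k w => beta k w) (y := fun k w => eta k w) (v := fun=> v)) => // j jk.
    exact: measurable_but_snd.
  by apply: measurable_but_fst; rewrite neq_ltn jk.
transitivity (\int[P]_w h1 (beta k w, (eta k w, (A k w, C k v w))))%E.
  by apply: eq_integral => w _; rewrite /h1 arrivalS.
transitivity (\int[e]_b \int[lam]_y \int[P]_w h1 (b, (y, (A k w, C k v w))))%E.
  rewrite (integral_independent beta_iid.1 beta_eta mG1 mh1 h10).
  apply: etrans (integral_iid _ _ beta_iid) _; apply: eq_integral => b _.
  have mh2 := measurableT_comp mh1 (pair1_measurable b).
  rewrite (integral_independent eta_iid.1 eta_beta mG2 mh2); last by move=> q; exact: h10.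
  exact: integral_iid eta_iid.
have mG : measurable_fun setT ((fun w => (A k w, C k v w)) : Omega -> (R * borelType V)%type).
  exact: measurable_omega_but mG2.
pose K (q : R * (borelType V * Omega)) := h1 (q.1, (q.2.1, (A k q.2.2, C k v q.2.2))).
have mK : measurable_fun setT K.
  apply: (measurableT_comp mh1); apply: measurable_fun_pair => //.
  apply: measurable_fun_pair.
    exact: measurableT_comp measurable_fst measurable_snd.
  exact: (measurableT_comp mG (measurableT_comp measurable_snd measurable_snd)).
apply: etrans (tonelli_reverse e lam P mK (fun q => h10 _)) _.
apply: eq_integral => w _; apply: eq_integral => y _.
rewrite /K /h1 /=; set a := A k w; set x := C k v w.
pose g (b : R) := f (S (t - a - b) (S b x + (y : V))).
have mg : measurable_fun setT g.
  apply: (measurableT_comp mf); apply: measurable_flow => //.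
    by apply: measurable_funB => //; exact: measurable_cst.
  by apply: measurable_vadd => //; exact: measurable_cst.
have := exponential_reflection theta_gt0 (beta_exp 0%N) (t - a) mg (fun b => f0 _).
rewrite /survival /survival_weight => E.
transitivity (\int[e]_b (((b <= t - a)%R%:R : R)%:E *
    (expR (- theta * (t - a - b)))%:E * g b))%E.
  apply: eq_integral => b _; rewrite lerBrDl /g.
  by rewrite (_ : t - (a + b) = t - a - b)//; ring.
rewrite E; apply: eq_integral => b _; rewrite lerBrDl -lerBrDr /g.
have -> : t - a - (t - a - b) = b by ring.
have -> : t - a - b = t - b - a by ring.
by congr (_ * f (S b _))%E; exact: addrC.
Qed.

(** The gap k is independent of the first k gaps and jumps, so its tail beyond
t - A k may be integrated out. *)
Lemma probability_in_gap v k t (B : set (borelType V)) : measurable B ->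
  P [set w | in_gap beta t k w /\ B (S (t - A k w) (C k v w))] =
  (\int[P]_w survival t (fun z => (\1_B z)%:E) (A k w) (C k v w))%E.
Proof.
move=> mB.
have beta_eta := independent_sequencesC eta_beta.
pose D := (R * (R * borelType V))%type.
pose c (q : R * borelType V) : \bar R := ((q.1 <= t)%R%:R%:E * (\1_B (S (t - q.1)%R q.2))%:E)%E.
pose h (q : D) : \bar R := ((t - q.2.1 < q.1)%R%:R%:E * c q.2)%E.
have mc : measurable_fun setT c.
  apply: emeasurable_funM; apply/measurable_EFinP.
    by apply: measurableT_comp => //; apply: measurable_fun_ler => //; exact: measurable_cst.
  apply: (measurableT_comp (f := \1_B : borelType V -> R)); first exact: measurable_indic.
  by apply: measurable_flow => //; apply: measurable_funB => //; exact: measurable_cst.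
have c0 q : (0 <= c q)%E by rewrite mule_ge0 ?lee_fin.
have mh : measurable_fun setT h.
  apply: emeasurable_funM; last exact: (measurableT_comp mc measurable_snd).
  apply/measurable_EFinP; apply: measurableT_comp => //; apply: measurable_fun_ltr => //.
  apply: measurable_funB; first exact: measurable_cst.
  exact: measurableT_comp measurable_fst measurable_snd.
have h0 q : (0 <= h q)%E by rewrite mule_ge0.
pose O1 : measurableType _ := omega_but beta eta k.
have mG1 : measurable_fun [set: O1] ((fun w => (A k w, C k v w)) : O1 -> (R * borelType V)%type).
  apply: measurable_fun_pair.
    apply: (measurable_partial_sum (X := O1) (b := fun k w => beta k w)) => j jk.
    by apply: measurable_but_fst; rewrite neq_ltn jk.
  apply: (measurable_forward V_separable S_lip S_meas (X := O1)
    (b := fun k w => beta k w) (y := fun k w => eta k w) (v := fun=> v)) => // j jk.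
    by apply: measurable_but_fst; rewrite neq_ltn jk.
  exact: measurable_but_snd.
have mG : measurable_fun setT ((fun w => (A k w, C k v w)) : Omega -> (R * borelType V)%type).
  exact: measurable_omega_but mG1.
set U := [set w | _].
have UE w : ((\1_U w)%:E = h (beta k w, (A k w, C k v w)))%E.
  have inU : (w \in U) = ((t - A k w < beta k w) &&
      ((A k w <= t) && (S (t - A k w) (C k v w) \in B))).
    rewrite ltrBlDl -arrivalS; apply/idP/idP.
      by move=> /set_mem[/andP[-> ->] ?]; rewrite mem_set.
    by move=> /and3P[h2 h1 /set_mem h3]; apply/mem_set; split => //; rewrite /in_gap h1.
  by rewrite /h /c /= !indicE inU -!EFinM -!natrM !mulnb.
have mU : measurable U.
  have mUh : measurable_fun setT (fun w => h (beta k w, (A k w, C k v w))).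
    by apply: (measurableT_comp mh); apply: measurable_fun_pair.
  have := mUh measurableT [set 1%E] (emeasurable_set1 _).
  rewrite setTI (_ : _ @^-1` _ = U)//; apply/seteqP; split => w /=; rewrite -UE indicE.
    by have [/set_mem//|_ [] /eqP] := boolP (w \in U); rewrite eq_sym oner_eq0.
  by move=> Uw; rewrite mem_set.
transitivity (\int[P]_w h (beta k w, (A k w, C k v w)))%E.
  have -> : P U = P (U `&` setT) by rewrite setIT.
  by rewrite -integral_indic//; apply: eq_integral => w _; exact: UE.
rewrite (integral_independent beta_iid.1 beta_eta mG1 mh h0).
apply: etrans (integral_iid _ _ beta_iid) _.
pose K (q : R * Omega) := h (q.1, (A k q.2, C k v q.2)).
have mK : measurable_fun setT K.
  apply: (measurableT_comp mh); apply: measurable_fun_pair => //.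
  exact: (measurableT_comp mG measurable_snd).
apply: etrans (fubini_tonelli (m1 := e) (m2 := P) K mK (fun q => h0 _)) _.
apply: eq_integral => w _; rewrite /K /h /c /survival /survival_weight /=.
case: (leP (A k w) t) => at0; last first.
  by rewrite !mul0e; apply: integral0_eq => b _; rewrite mule0.
rewrite !mul1e; set i := (\1_B _)%:E.
have ta : 0 <= t - A k w by rewrite subr_ge0.
have := exponential_shift theta_gt0 (beta_exp 0%N) ta (g := fun=> i)
  (measurable_cst _) (fun _ => _).
by rewrite integral_probability_cst; apply => b; rewrite lee_fin.
Qed.

Context (mu : probability (borelType V) R).
Context (M : probability (Omega * borelType V)%type R).
Hypothesis ME : M = (P \x mu)%E :> (set _ -> \bar R).

Lemma integral_product (F : Omega * borelType V -> \bar R) :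
  measurable_fun setT F -> (forall z, 0 <= F z)%E ->
  (\int[M]_z F z = \int[mu]_v \int[P]_w F (w, v))%E.
Proof. by move=> mF F0; rewrite ME; exact: (fubini_tonelli2 (m1 := P) (m2 := mu) F mF F0). Qed.

(** The integral of f (X t) over the event that exactly k jumps occur before t,
for the process started from mu. *)
Definition jump_part (k : nat) (t : R) (f : borelType V -> \bar R) : \bar R :=
  (\int[M]_z survival t f (A k z.1) (C k z.2 z.1))%E.

Let D := ((Omega * borelType V) * (borelType V * R))%type.
Let K k t (f : borelType V -> \bar R) (q : D) :=
  survival (t - q.2.2) (fun z => f (kick q.2.2 q.2.1 z)) (A k q.1.1) (C k q.1.2 q.1.1).

Let measurable_K k t (f : borelType V -> \bar R) :
  measurable_fun setT f -> measurable_fun setT (K k t f).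
Proof.
move=> mf; have m22 : measurable_fun setT (fun q : D => q.2.2).
  exact: measurableT_comp measurable_snd measurable_snd.
apply: measurable_survival_kick => //.
- by apply: measurable_funB => //; exact: measurable_cst.
- exact: (measurableT_comp (measurable_arrival k) (measurableT_comp measurable_fst measurable_fst)).
- exact: (measurableT_comp (measurable_state k) measurable_fst).
- exact: measurableT_comp measurable_fst measurable_snd.
Qed.

(** Decomposition by the time b elapsed since the last jump y. *)
Lemma jump_partS k t (f : borelType V -> \bar R) :
  measurable_fun setT f -> (forall z, 0 <= f z)%E ->
  (jump_part k.+1 t f =
   \int[e]_b \int[lam]_y jump_part k (t - b)%R (fun z => f (kick b y z)))%E.
Proof.
move=> mf f0.
have mS j : measurable_fun setT (fun z : Omega * borelType V =>
    survival t f (A j z.1) (C j z.2 z.1)).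
  apply: measurable_survival => //; last exact: measurable_state.
  exact: (measurableT_comp (measurable_arrival j) measurable_fst).
rewrite /jump_part integral_product//; last by move=> z; exact: survival_ge0.
under eq_integral do rewrite (integral_survival_step _ _ _ mf f0).
have mK := measurable_K k t mf.
have K0 q : (0 <= K k t f q)%E by exact: survival_ge0.
rewrite -(tonelli_reverse M lam e mK K0).
pose F (z : Omega * borelType V) := (\int[lam]_y \int[e]_b K k t f (z, (y, b)))%E.
have F0 z : (0 <= F z)%E.
  by apply: integral_ge0 => y _; apply: integral_ge0 => b _; exact: K0.
suff mF : measurable_fun setT F by exact: esym (integral_product mF F0).
have mK' : measurable_fun setT
    (fun q : (Omega * borelType V) * borelType V * R => K k t f (q.1.1, (q.1.2, q.2))).
  apply: (measurableT_comp mK); apply: measurable_fun_pair.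
    exact: measurableT_comp measurable_fst measurable_fst.
  apply: measurable_fun_pair => //; exact: measurableT_comp measurable_snd measurable_fst.
have m2 := measurable_fun_fubini_tonelli_F (m2 := e) _ mK' (fun q => K0 _).
have F20 q : (0 <= fubini_F e (fun q : (Omega * borelType V) * borelType V * R =>
   K k t f (q.1.1, (q.1.2, q.2))) q)%E.
  by apply: integral_ge0 => b _; exact: K0.
exact: (measurable_fun_fubini_tonelli_F (m2 := lam) _ m2 F20).
Qed.

Let measurable_jump_part_kick k t (f : borelType V -> \bar R) :
  measurable_fun setT f -> (forall z, 0 <= f z)%E ->
  measurable_fun setT (fun q : borelType V * R =>
    jump_part k (t - q.2) (fun z => f (kick q.2 q.1 z))).
Proof.
move=> mf f0; have K0 q : (0 <= K k t f q)%E by exact: survival_ge0.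
have := measurable_fun_fubini_tonelli_G (m1 := M) _ (measurable_K k t mf) K0.
by rewrite (_ : fubini_G M (K k t f) = (fun q : borelType V * R =>
  jump_part k (t - q.2) (fun z => f (kick q.2 q.1 z))))//; apply/funext => -[y b].
Qed.

Lemma jump_part_ge0 k t (f : borelType V -> \bar R) :
  (forall z, 0 <= f z)%E -> (0 <= jump_part k t f)%E.
Proof. by move=> f0; apply: integral_ge0 => z _; exact: survival_ge0. Qed.

Lemma jump_part_lt0 k t (f : borelType V -> \bar R) : t < 0 -> jump_part k t f = 0%E.
Proof.
move=> t0; apply: integral0_eq => z _; rewrite /survival /survival_weight.
by rewrite leNgt (lt_le_trans t0) ?arrival_ge0//= !mul0e.
Qed.

Hypothesis mu_fixpoint : forall f : borelType V -> \bar R,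
  measurable_fun setT f -> (forall v, 0 <= f v)%E ->
  (\int[mu]_v f v = \int[e]_b \int[lam]_y \int[mu]_z f (kick b y z))%E.

(** The mean of f at time b after a jump into a state with mu as law just before
the jump; by the fixed point equation its mean over b is the integral of f. *)
Definition after_jump (f : borelType V -> \bar R) (b : R) : \bar R :=
  (\int[lam]_y \int[mu]_z f (kick b y z))%E.

Lemma after_jump_ge0 f b : (forall v, 0 <= f v)%E -> (0 <= after_jump f b)%E.
Proof. by move=> f0; apply: integral_ge0 => y _; apply: integral_ge0. Qed.

Let measurable_kick_mu (f : borelType V -> \bar R) :
  measurable_fun setT f -> (forall v, 0 <= f v)%E ->
  measurable_fun setT (fun q : borelType V * R => \int[mu]_z f (kick q.2 q.1 z))%E.
Proof.
move=> mf f0; pose h (p : (borelType V * R) * borelType V) := f (kick p.1.2 p.1.1 p.2).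
have mh : measurable_fun setT h.
  apply: (measurableT_comp mf); apply: measurable_kick => //.
    exact: measurableT_comp measurable_snd measurable_fst.
  exact: measurableT_comp measurable_fst measurable_fst.
exact: (measurable_fun_fubini_tonelli_F (m2 := mu) h mh (fun p => f0 _)).
Qed.

Lemma measurable_after_jump (f : borelType V -> \bar R) :
  measurable_fun setT f -> (forall v, 0 <= f v)%E ->
  measurable_fun setT (after_jump f).
Proof.
move=> mf f0; have mh := measurable_kick_mu mf f0.
apply: (measurable_fun_fubini_tonelli_G (m1 := lam) _ mh) => q.
by apply: integral_ge0.
Qed.

(** By the fixed point equation the initial state can be taken as the state at an
exponential time b after a jump; running the flow for a further time t without
jump amounts, by absence of memory, to b being conditioned on exceeding t. *)
Lemma jump_part0 t (f : borelType V -> \bar R) : 0 <= t ->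
  measurable_fun setT f -> (forall z, 0 <= f z)%E ->
  (jump_part 0 t f = \int[e]_b ((t < b)%R%:R%:E * after_jump f b))%E.
Proof.
move=> t0 mf f0.
have mfS : measurable_fun setT (fun v : borelType V => f (S t v)).
  by apply: (measurableT_comp mf); apply: measurable_flow => //; exact: measurable_cst.
have mS : measurable_fun setT (fun z : Omega * borelType V =>
    survival t f (A 0 z.1) (C 0 z.2 z.1)).
  apply: measurable_survival => //; last exact: (measurable_state 0).
  exact: (measurableT_comp (measurable_arrival 0) measurable_fst).
transitivity (\int[mu]_v ((expR (- theta * t))%:E * f (S t v)))%E.
  rewrite /jump_part (integral_product mS); last by move=> z; exact: survival_ge0.
  apply: eq_integral => v _.
  rewrite -[RHS](integral_probability_cst P); apply: eq_integral => w _.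
  by rewrite /survival /survival_weight arrival0 subr0 t0 mul1e.
rewrite ge0_integralZl//.
have mk := measurable_after_jump mf f0.
have k0 b : (0 <= after_jump f b)%E by exact: after_jump_ge0.
have mshift : measurable_fun setT (fun b : R => after_jump f (b + t)).
  by apply: (measurableT_comp mk); apply: measurable_funD => //; exact: measurable_cst.
have muE : (\int[mu]_v f (S t v) = \int[e]_b after_jump f (b + t)%R)%E.
  apply: etrans (mu_fixpoint mfS (fun v => f0 _)) _.
  apply: (eq_exponential_ge0 theta_gt0 (beta_exp 0%N)
    (f := after_jump (fun v => f (S t v))) (g := fun b => after_jump f (b + t))).
  - by apply: (measurable_after_jump mfS) => v; exact: f0.
  - by move=> b; exact: (after_jump_ge0 (f := fun v => f (S t v))).
  - exact: mshift.
  - by move=> b; exact: k0.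
  - move=> b b0; rewrite /after_jump; apply: eq_integral => y _; apply: eq_integral => z _.
    by rewrite -S_add// addrC.
by rewrite muE (exponential_shift theta_gt0 (beta_exp 0%N) t0 mk k0).
Qed.

(** The part without jumps corresponds to b > t in the fixed point equation, and
by induction the parts with jumps contribute at most the case b <= t. *)
Lemma sum_jump_part_le n t (f : borelType V -> \bar R) :
  measurable_fun setT f -> (forall z, 0 <= f z)%E ->
  (\sum_(k < n) jump_part k t f <= (0 <= t)%R%:R%:E * \int[mu]_v f v)%E.
Proof.
elim: n t f => [|n ih] t f mf f0.
  by rewrite big_ord0 mule_ge0// integral_ge0.
have [t0|t0] := leP 0 t; last first.
  by rewrite big1 ?mul0e// => k _; rewrite jump_part_lt0.
rewrite mul1e big_ord_recl /= (jump_part0 t0 mf f0).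
under eq_bigr do rewrite /bump /= add1n (jump_partS _ _ mf f0).
have mocc k := measurable_jump_part_kick k t mf f0.
have mocc1 k b : measurable_fun setT (fun y : borelType V =>
    jump_part k (t - b) (fun z => f (kick b y z))).
  exact: measurableT_comp (mocc k) (pair2_measurable b).
have mocc2 k : measurable_fun setT (fun b : R =>
    \int[lam]_y jump_part k (t - b)%R (fun z => f (kick b y z)))%E.
  apply: (measurable_fun_fubini_tonelli_G (m1 := lam) _ (mocc k)) => q.
  exact: jump_part_ge0.
rewrite -ge0_integral_sum//; last first.
  by move=> k b _; apply: integral_ge0 => y _; exact: jump_part_ge0.
have mk := measurable_after_jump mf f0.
have k0 b : (0 <= after_jump f b)%E by exact: after_jump_ge0.
have mle : measurable_fun setT (fun b : R => ((b <= t)%R%:R : R)%:E).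
  by apply/measurable_EFinP; apply: measurableT_comp => //; exact: measurable_fun_ler.
have mlt : measurable_fun setT (fun b : R => ((t < b)%R%:R : R)%:E).
  by apply/measurable_EFinP; apply: measurableT_comp => //; exact: measurable_fun_ltr.
rewrite (mu_fixpoint mf f0).
rewrite [leRHS](_ : _ = \int[e]_b ((t < b)%R%:R%:E * after_jump f b) +
   \int[e]_b ((b <= t)%R%:R%:E * after_jump f b))%E; last first.
  rewrite -ge0_integralD//=; last 4 first.
  - by move=> b _; rewrite mule_ge0.
  - exact: emeasurable_funM.
  - by move=> b _; rewrite mule_ge0.
  - exact: emeasurable_funM.
  apply: eq_integral => b _; rewrite -/(after_jump f b).
  by case: (ltP t b) => _; rewrite mul1e mul0e ?adde0 ?add0e.
apply: leeD => //; apply: ge0_le_integral => //=.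
- move=> b _; apply: sume_ge0 => k _; apply: integral_ge0 => y _.
  exact: jump_part_ge0.
- by apply: emeasurable_sum => k.
- exact: emeasurable_funM.
move=> b _; rewrite -ge0_integral_sum//; last first.
  by move=> k y _; exact: jump_part_ge0.
have mkb : measurable_fun setT (fun y : borelType V => \int[mu]_z f (kick b y z))%E.
  exact: measurableT_comp (measurable_kick_mu mf f0) (pair2_measurable b).
rewrite /after_jump -ge0_integralZl//; last first.
  by move=> y _; apply: integral_ge0.
apply: ge0_le_integral => //=.
- by move=> y _; apply: sume_ge0 => k _; exact: jump_part_ge0.
- by apply: emeasurable_sum => k.
- exact: emeasurable_funM.
- move=> y _; rewrite -subr_ge0; apply: ih => //.
  by apply: (measurableT_comp mf); apply: measurable_kick => //; exact: measurable_cst.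
Qed.

End invariance.

(** * Invariance and uniqueness for the transition function *)

Section transition_function.
Context d (Omega : measurableType d) (R : realType) (P : probability Omega R).
Context (V : completeNormedModType R).
Hypothesis V_separable : separable_space V.
Variable T : R -> V -> V.
Variable S : R -> V -> V.
Hypothesis SE : forall t v, S t v = T (Num.max 0 t) v.
Hypothesis S_lip : forall t v w, `|S t v - S t w| <= `|v - w|.
Hypothesis S_meas : forall v, measurable_fun setT ((S^~ v) : R -> borelType V).
Hypothesis S_coalesce : forall e : R, 0 < e ->
  exists M, forall t, M <= t -> forall v w, `|S t v - S t w| <= e.
Hypothesis S_add : forall s t v, 0 <= s -> 0 <= t -> S (s + t) v = S s (S t v).
Context (eta : nat -> {RV P >-> borelType V}) (beta : nat -> {RV P >-> R}).
Hypothesis eta_iid : iid eta.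
Hypothesis beta_iid : iid beta.
Hypothesis beta_gt0 : forall k w, 0 < beta k w.
Context (theta : R).
Hypothesis theta_gt0 : 0 < theta.
Hypothesis beta_exp : forall k, exponentially_distributed theta (beta k).
Hypothesis eta_beta : independent_sequences eta beta.

Local Notation A k := (arrival beta k).
Local Notation C k v := (forward S (fun j w => beta j w) (fun j w => (eta j w : V)) v k).
Local Notation X := (process T eta beta).
Local Notation tr := (transition T eta beta).

Lemma chainE v k w : chain T eta beta v k w = C k v w.
Proof. by elim: k => [//|k ih] /=; rewrite ih SE max_r// ltW. Qed.

Lemma process_state v t k w : in_gap beta t k w -> X v t w = S (t - A k w) (C k v w).
Proof. by move=> ak; rewrite (process_in_gap _ _ beta_gt0 _ ak) chainE SE. Qed.

Let measurable_in_gap t k : measurable_fun setT (fun w => in_gap beta t k w).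
Proof.
apply: measurable_and.
- by apply: measurable_fun_ler; [exact: measurable_arrival|exact: measurable_cst].
- by apply: measurable_fun_ltr; [exact: measurable_cst|exact: measurable_arrival].
Qed.

Let measurable_in_gap_set t k : measurable [set w | in_gap beta t k w].
Proof.
rewrite -[X in measurable X]setTI.
exact: (measurable_in_gap t k measurableT (Y := [set true])).
Qed.

Lemma process_preimage t (B : set V) :
  [set z : Omega * borelType V | B (X z.2 t z.1)] =
  \bigcup_k ([set z | in_gap beta t k z.1] `&`
    [set z | B (S (t - A k z.1) (C k z.2 z.1))]) `|`
  (\bigcap_k ~` [set z | in_gap beta t k z.1]) `&` [set z | B 0].
Proof.
apply/seteqP; split => [z /= Bz|z /= [[k _ [/= ak]]|[dz]]].
- have [[k ak]|nogap] := pselect (exists k, in_gap beta t k z.1).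
    by left; exists k => //; split => //=; rewrite -process_state.
  right; split; first by move=> k _ /= ak; apply: nogap; exists k.
  rewrite -(@process_no_gap _ _ _ _ _ T eta beta z.2 t z.1) => // k.
  by apply/negP => ak; apply: nogap; exists k.
- by rewrite -process_state.
- rewrite -(@process_no_gap _ _ _ _ _ T eta beta z.2 t z.1) => // k.
  by apply/negP; exact: dz k I.
Qed.

Lemma measurable_process_piece t k B : measurable (B : set (borelType V)) ->
  measurable [set z : Omega * borelType V | B (S (t - A k z.1) (C k z.2 z.1))].
Proof.
move=> mB; have mS : measurable_fun setT ((fun z => S (t - A k z.1) (C k z.2 z.1)) :
      (Omega * borelType V)%type -> borelType V).
  apply: (measurable_flow S_lip V_separable S_meas (X := (Omega * borelType V)%type)
    (f := fun z => t - A k z.1) (g := fun z => C k z.2 z.1)); last exact: measurable_state.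
  apply: measurable_funB; first exact: measurable_cst.
  exact: measurableT_comp (measurable_arrival _ _) measurable_fst.
by have := mS measurableT B mB; rewrite setTI.
Qed.

Lemma measurable_process t :
  measurable_fun setT (fun z : Omega * borelType V => X z.2 t z.1 : borelType V).
Proof.
move=> _ B mB; rewrite setTI.
rewrite -[_ @^-1` _]/[set z : Omega * borelType V | B (X z.2 t z.1)] process_preimage.
have mgap k : measurable [set z : Omega * borelType V | in_gap beta t k z.1].
  rewrite -[X in measurable X]setTI.
  exact: (@measurable_fst _ _ Omega (borelType V) measurableT _ (measurable_in_gap_set t k)).
apply: measurableU.
  apply: bigcupT_measurable => k; apply: measurableI => //.
  exact: measurable_process_piece.
apply: measurableI.
  by apply: bigcap_measurable => // k _; exact: measurableC.
have [B0|B0] := pselect (B (0 : V)).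
  by rewrite (_ : [set _ | _] = setT)//; apply/seteqP; split.
by rewrite (_ : [set _ | _] = set0)//; apply/seteqP; split.
Qed.

Lemma measurable_process_event v t B : measurable (B : set (borelType V)) ->
  measurable [set w | B (X v t w)].
Proof.
move=> mB; have := measurableT_comp (measurable_process t) (pair2_measurable (v : borelType V)).
by move=> /(_ measurableT B mB); rewrite setTI.
Qed.

Lemma measurable_transition t B : measurable (B : set (borelType V)) ->
  measurable_fun setT (fun v : borelType V => tr t v B).
Proof.
move=> mB; have := measurable_process t measurableT mB; rewrite setTI => mXB.
have := measurable_fun_ysection P mXB.
rewrite (_ : _ \o _ = fun v : borelType V => tr t v B)//.
apply/funext => v; rewrite /transition /=; congr (P _).
by apply/seteqP; split => w; rewrite /ysection /= inE.
Qed.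

Lemma transition_setC t v B : measurable (B : set (borelType V)) ->
  tr t v (~` B) = (1 - tr t v B)%E.
Proof.
move=> mB; rewrite /transition -probability_setC; last exact: measurable_process_event.
by [].
Qed.

(** Outside a null set the gaps are unbounded, so t lies between two consecutive
jumps and the transition function is the sum of its parts. *)
Lemma integral_transition_le (mu : probability (borelType V) R) :
  (forall f : borelType V -> \bar R,
    measurable_fun setT f -> (forall v, 0 <= f v)%E ->
    (\int[mu]_v f v = \int[distribution P (beta 0%N)]_b
       \int[distribution P (eta 0%N)]_y \int[mu]_z f (S b ((y : V) + (z : V))%R))%E) ->
  forall t B, 0 <= t -> measurable B -> (\int[mu]_v tr t v B <= mu B)%E.
Proof.
move=> mu_fix t B t0 mB.
have [M ME] := product_probability P mu.
pose f (z : borelType V) : \bar R := (\1_B z)%:E.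
have mf : measurable_fun setT f by apply/measurable_EFinP; exact: measurable_indic.
have f0 z : (0 <= f z)%E by rewrite lee_fin.
pose p k v := (\int[P]_w survival S theta t f (A k w) (C k v w))%E.
have p0 k v : (0 <= p k v)%E by apply: integral_ge0 => w _; exact: survival_ge0.
have mS k : measurable_fun setT (fun z : Omega * borelType V =>
    survival S theta t f (A k z.1) (C k z.2 z.1)).
  apply: (measurable_survival V_separable S_lip S_meas) => //.
    exact: measurableT_comp (measurable_arrival _ _) measurable_fst.
  exact: measurable_state.
have S0 k z : (0 <= survival S theta t f (A k z.1) (C k z.2 z.1))%E by exact: survival_ge0.
have mp k : measurable_fun setT (fun v : borelType V => p k v).
  exact: (measurable_fun_fubini_tonelli_G (m1 := P) _ (mS k) (S0 k)).
have trle v : (tr t v B <= \sum_(k <oo) p k v)%E.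
  pose piece k := [set w | in_gap beta t k w /\ B (S (t - A k w) (C k v w))].
  have pE k : P (piece k) = p k v.
    exact: (probability_in_gap V_separable S_lip S_meas beta_iid theta_gt0 beta_exp eta_beta).
  have mpiece k : measurable (piece k).
    apply: measurableI; first exact: measurable_in_gap_set.
    rewrite -[X in measurable X]setTI.
    exact: (@pair2_measurable _ _ Omega (borelType V) v measurableT _
      (measurable_process_piece t k mB)).
  have mU : measurable (\bigcup_k piece k) by exact: bigcupT_measurable.
  have mr : measurable (~` unbounded_gaps beta) by apply: measurableC; exact: measurable_unbounded_gaps.
  under eq_eseriesr do rewrite -pE.
  apply: le_trans (generalized_Boole_inequality P mpiece mU).
  rewrite -[leRHS]adde0 -(probability_unbounded_gapsC theta_gt0 beta_iid beta_exp).
  apply: le_trans (measureU2 _ mU mr); apply: le_measure; rewrite ?inE.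
  - exact: measurable_process_event.
  - exact: measurableU.
  - move=> w /= Bw; have [rw|] := pselect (unbounded_gaps beta w); last by right.
    left; have [k tk] := unbounded_gapsP (t + 1) rw.
    have tA : t < A k.+1 w.
      have Ak0 : 0 <= A k w by exact: arrival_ge0.
      rewrite arrivalS; lra.
    have [j _ aj] := in_gap_exists t0 tA.
    by exists j => //; split => //; rewrite -process_state.
apply: (@le_trans _ _ (\int[mu]_v \sum_(k <oo) p k v)%E).
  apply: ge0_le_integral => //.
  - exact: measurable_transition.
  - by apply: (ge0_emeasurable_sum (P := xpredT)).
rewrite integral_nneseries//.
have pE k : (\int[mu]_v p k v)%E = jump_part S eta beta theta M k t f.
  by rewrite /jump_part (integral_product ME (mS k)).
under eq_eseriesr do rewrite pE.
apply: lime_le; first by apply: is_cvg_nneseries => k _ _; exact: jump_part_ge0.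
apply: nearW => n; rewrite big_mkord.
have := sum_jump_part_le V_separable S_lip S_meas S_add eta_iid beta_iid beta_gt0
  theta_gt0 beta_exp eta_beta ME mu_fix n t mf f0.
by rewrite t0 mul1e integral_indic// setIT.
Qed.

(** The inequality just proved, for a set and for its complement. *)
Lemma fixpoint_invariant (mu : probability (borelType V) R) :
  (forall f : borelType V -> \bar R,
    measurable_fun setT f -> (forall v, 0 <= f v)%E ->
    (\int[mu]_v f v = \int[distribution P (beta 0%N)]_b
       \int[distribution P (eta 0%N)]_y \int[mu]_z f (S b ((y : V) + (z : V))%R))%E) ->
  invariant_measure T eta beta mu.
Proof.
move=> mu_fix t B t0 mB; apply/eqP; rewrite eq_le integral_transition_le//=.
have mBC := measurableC mB.
have sumE : (\int[mu]_v tr t v B + \int[mu]_v tr t v (~` B) = 1)%E.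
  rewrite -ge0_integralD//; [|exact: measurable_transition..].
  rewrite -[RHS](integral_probability_cst mu); apply: eq_integral => v _.
  rewrite transition_setC// addeC subeK//.
  by rewrite /transition fin_num_measure//; exact: measurable_process_event.
have := integral_transition_le mu_fix t0 mBC.
rewrite probability_setC//; move: sumE.
have muB : mu B \is a fin_num by rewrite fin_num_measure.
set a := (\int[mu]_v tr t v B)%E; set b := (\int[mu]_v tr t v (~` B))%E.
have afin : a \is a fin_num.
  rewrite ge0_fin_numE ?integral_ge0// (le_lt_trans (integral_transition_le mu_fix t0 mB))//.
  by rewrite ltey_eq muB.
move=> ab; have -> : b = (1 - a)%E by rewrite -ab addeC addeK.
rewrite -(fineK muB) -(fineK afin) -!EFinB !lee_fin; lra.
Qed.


Definition no_long_gap (M t : R) : set Omega :=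
  [set w | forall j, A j.+1 w <= t -> beta j w < M].

Lemma measurable_no_long_gap M t : measurable (no_long_gap M t).
Proof.
rewrite (_ : no_long_gap M t = \bigcap_j
    ((A j.+1 @^-1` `]t, +oo[) `|` (beta j @^-1` `]-oo, M[))).
  apply: bigcap_measurable => // j _; apply: measurableU.
    rewrite -[X in measurable X]setTI.
    exact: (measurable_arrival beta j.+1 measurableT (measurable_itv _)).
  by rewrite -[X in measurable X]setTI; exact: (measurable_funPT (beta j)).
apply/seteqP; split => w h j; last first.
  by have := h j I; rewrite /= !in_itv /= andbT => -[/lt_geF->|].
move=> _; rewrite /= !in_itv /= andbT; have [At|tA] := leP (A j.+1 w) t.
  by right; exact: h.
by left.
Qed.

Lemma cvg_probability_no_long_gap M : P (no_long_gap M n%:R) @[n --> \oo] --> 0%E.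
Proof.
have sub : \bigcap_n no_long_gap M n%:R `<=` \bigcap_n short_gaps beta M n.
  move=> w h n _ k _; apply: (h (Num.bound (A k.+1 w)) I).
  by rewrite ltW// archi_boundP// arrival_ge0.
have mcap : measurable (\bigcap_n no_long_gap M n%:R).
  by apply: bigcap_measurable => // n _; exact: measurable_no_long_gap.
have -> : 0%E = P (\bigcap_n no_long_gap M n%:R).
  apply/esym/eqP; rewrite eq_le measure_ge0 andbT.
  rewrite -(probability_bigcap_short_gaps theta_gt0 beta_iid beta_exp M).
  apply: le_measure; rewrite ?inE//.
  by apply: bigcap_measurable => // n _; exact: measurable_short_gaps.
apply: nonincreasing_cvg_mu => //.
- by rewrite ltey_eq fin_num_measure//; exact: measurable_no_long_gap.
- by move=> n; exact: measurable_no_long_gap.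
- move=> m n mn; apply/subsetPset => w h j At; apply: h.
  by rewrite (le_trans At)// ler_nat.
Qed.

Lemma forward_coalesce j k v v' w (r : R) : (j < k)%N ->
  (forall u u', `|S (beta j w) u - S (beta j w) u'| <= r) ->
  `|C k v w - C k v' w| <= r.
Proof.
move=> + bj; elim: k => [//|k ih]; rewrite ltnS leq_eqVlt /= => jk.
rewrite opprD addrACA subrr addr0; case/predU1P: jk => [<-//|jk].
exact: le_trans (S_lip _ _ _) (ih jk).
Qed.

Lemma process_coalesce M t r v v' w : 0 < r ->
  (forall t, M <= t -> forall u u', `|S t u - S t u'| <= r) ->
  ~ no_long_gap M t w -> `|X v t w - X v' t w| <= r.
Proof.
move=> r0 SM unc; have [[k ak]|nogap] := pselect (exists k, in_gap beta t k w); last first.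
  rewrite !process_no_gap ?subr0 ?normr0 ?ltW// => k; apply/negP => ak; apply: nogap;
  by exists k.
rewrite !(process_state _ ak); apply: le_trans (S_lip _ _ _) _.
have [j jP] : exists j, A j.+1 w <= t /\ M <= beta j w.
  apply: contrapT => h; apply: unc => j At; rewrite ltNge; apply/negP => Mb.
  by apply: h; exists j.
apply: (forward_coalesce (j := j)); last by move=> u u'; exact: SM jP.2 _ _.
rewrite ltnNge; apply/negP => kj; have /andP[_] := ak; apply/negP; rewrite -leNgt.
by apply: le_trans jP.1; apply: le_arrival.
Qed.

(** Both processes are driven by the same gaps and jumps. *)
Lemma transition_couple M t r v v' (F : set V) : closed F -> 0 < r ->
  (forall t, M <= t -> forall u u', `|S t u - S t u'| <= r / 2) ->
  (tr t v F <= tr t v' (thickening F r) + P (no_long_gap M t))%E.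
Proof.
move=> cF r0 SM.
have mX u : measurable_fun setT (X u t : Omega -> borelType V).
  exact: measurableT_comp (measurable_process t) (pair2_measurable (u : borelType V)).
have r2 : 0 < r / 2 by rewrite divr_gt0.
apply: le_trans (close_laws V_separable P r (closed_borel cF) (mX v) (mX v')) _.
apply: leeD => //; apply: le_measure; rewrite ?inE.
- exact: measurable_set_dist_ge.
- exact: measurable_no_long_gap.
- move=> w /= rX; apply: contrapT => /(process_coalesce v v' r2 SM) /(le_trans rX).
  by rewrite leNgt ltr_pdivrMr// ltr_pMr// ltr1n.
Qed.

Lemma invariant_unique (mu nu : probability (borelType V) R) :
  invariant_measure T eta beta mu -> invariant_measure T eta beta nu ->
  forall B, measurable B -> nu B = mu B.
Proof.
move=> mu_inv nu_inv; apply: eq_probability_thickening => F r dl cF r0 dl0.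
have r2 : 0 < r / 2 by rewrite divr_gt0.
have [M SM] := S_coalesce r2.
have [n _ /(_ n (leqnn n)) Pn] := cvge0_near_le dl0 (cvg_probability_no_long_gap M).
have mF := closed_borel cF; have mFr : measurable (thickening F r : set (borelType V)).
  exact: measurable_thickening.
have n0 : 0 <= n%:R :> R by [].
have nuF v' : (nu F <= tr n%:R v' (thickening F r) + dl%:E)%E.
  rewrite -(nu_inv n%:R F)// -[leRHS](integral_probability_cst nu).
  apply: ge0_le_integral => //; first exact: measurable_transition.
  move=> v _; apply: le_trans (transition_couple _ v v' cF r0 SM) _.
  exact: leeD.
rewrite -(mu_inv n%:R _ n0 mFr) -[leLHS](integral_probability_cst mu).
rewrite -[dl%:E](integral_probability_cst mu) -ge0_integralD//.
- apply: ge0_le_integral => //.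
  by apply: emeasurable_funD => //; exact: measurable_transition.
- exact: measurable_transition.
- by move=> v _; rewrite lee_fin ltW.
Qed.

End transition_function.

(** * The flow on the positive half-line *)

Section flow.
Context (R : realType) (V : completeNormedModType R) (T : R -> V -> V).

Lemma time_continuous_measurable v : time_continuous T ->
  measurable_fun setT ((fun t => T (Num.max 0 t) v) : R -> borelType V).
Proof.
move=> Tc; apply: (@measurability _ _ R (borelType V) setT _ (@open V) _) => //.
move=> _ [U oU <-]; rewrite setTI; apply: open_measurable.
move: U oU; apply/continuousP => t.
have := Tc v; move/subspace_continuousP => /(_ (Num.max 0 t)).
rewrite /= in_itv /= andbT le_max lexx => /(_ isT) Tct.
apply: (cvg_comp (fun s : R => Num.max 0 s) (fun s => T s v) _ Tct) => U; rewrite /within /= => nU.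
have cmax : {for t, continuous (fun s : R => Num.max 0 s)}.
  by apply: continuous_max; [exact: cvg_cst|exact: cvg_id].
have max_ge0 s : 0 <= Num.max 0 s :> R by rewrite le_max lexx.
have tU : \forall s \near t, Num.max 0 s \in `[0, +oo[ -> U (Num.max 0 s).
  exact: cmax _ nU.
apply: filterS tU => s; apply.
by rewrite in_itv /= andbT; exact: max_ge0.
Qed.

(** The term `|w1 - w2| `^ (- rho^-1) only improves the decay estimate; dropping it
leaves a bound independent of w1 and w2, which passes to V by density. *)
Lemma decay_coalesce (W : completeNormedModType R) (inj : {linear W -> V})
    (kappa rho : R) :
  contractive T -> continuous inj -> dense (range inj) -> leaves_invariant inj T ->
  0 < kappa -> 0 < rho -> decay_estimate inj T kappa rho ->
  forall e : R, 0 < e ->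
  exists M, forall t, M <= t ->
    forall v w, `|T (Num.max 0 t) v - T (Num.max 0 t) w| <= e.
Proof.
move=> Tcontr cinj dinj Tinv kappa0 rho0 Tdecay e e0.
have [C C0 injC] : exists2 C, 0 < C & forall x, `|inj x| <= C * `|x|.
  by have /linear_bounded_continuous/linear_boundedP/pinfty_ex_gt0 := cinj.
(* Chosen so that C * (kappa * M) `^ (- rho) = e. *)
pose M := (e / C) `^ (- rho^-1) / kappa.
have M0 : 0 < M by rewrite divr_gt0// powR_gt0// divr_gt0.
exists M => t Mt v w.
have t0 : 0 < t by exact: lt_le_trans Mt.
rewrite max_r; last exact: ltW.
have key w1 w2 : `|T t (inj w1) - T t (inj w2)| <= e.
  have [u1 _ u1E] := Tinv t w1 (ltW t0); have [u2 _ u2E] := Tinv t w2 (ltW t0).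
  rewrite -u1E -u2E -linearB; apply: le_trans (injC _) _.
  rewrite -ler_pdivlMl// mulrC.
  apply: le_trans (Tdecay t w1 w2 u1 u2 (ltW t0) u1E u2E) _.
  rewrite /decay; case: ifPn => [_|_]; first by rewrite ltW// divr_gt0.
  have -> : e / C = (kappa * M) `^ (- rho).
    rewrite /M mulrCA divff ?mulr1 ?gt_eqF// -powRrM mulrNN mulVf ?gt_eqF//.
    by rewrite powRr1// ltW// divr_gt0.
  have kM : 0 < kappa * M by rewrite mulr_gt0.
  have kt : kappa * M <= kappa * t + `|w1 - w2| `^ (- rho^-1).
    by rewrite -[leLHS]addr0 lerD ?powR_ge0// ler_pM2l.
  have kt0 := lt_le_trans kM kt.
  rewrite !(powRN _ rho) lef_pV2 ?posrE ?powR_gt0//.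
  by apply: ge0_ler_powR; rewrite ?nnegrE //; exact: ltW.
apply/ler_addgt0Pr => r r0; have r2 : 0 < r / 2 by rewrite divr_gt0.
have dW x : exists w1, `|inj w1 - x| < r / 2.
  have [||y [xy [w1 _ w1y]]] := dinj (ball x (r / 2)).
  - by exists x; exact: ballxx.
  - exact: ball_open.
  exists w1; rewrite w1y distrC; move: xy; rewrite -ball_normE; exact.
have [w1 h1] := dW v; have [w2 h2] := dW w.
have c1 := Tcontr t (inj w1) v (ltW t0); have c2 := Tcontr t (inj w2) w (ltW t0).
have k12 := key w1 w2.
rewrite -(subrKA (T t (inj w1))) (le_trans (ler_normD _ _))//.
have := ler_normD (T t (inj w1) - T t (inj w2)) (T t (inj w2) - T t w).
rewrite subrKA (distrC (T t v)); lra.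
Qed.

End flow.

Theorem proposition0p4p3
  (R : realType)
  (d : measure_display) (Omega : measurableType d) (P : probability Omega R)
  (P_complete : measure_is_complete P)
  (V : completeNormedModType R)
  (V_separable : separable_space V)
  (V_nontrivial : exists v : V, v != 0)
  (T : R -> V -> V)
  (T_semigroup : semigroup T)
  (T_continuous : time_continuous T)
  (T_contractive : contractive T)
  (eta : nat -> {RV P >-> borelType V})
  (eta_iid : iid eta)
  (eta_L2 : forall k, (fun w => `|(eta k w : V)|) \in Lfun P 2%:E)
  (theta : R) (theta_gt0 : 0 < theta)
  (beta : nat -> {RV P >-> R})
  (beta_gt0 : forall k w, 0 < beta k w)
  (beta_iid : iid beta)
  (beta_exp : forall k, exponentially_distributed theta (beta k))
  (eta_beta_independent : independent_sequences eta beta)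
  (W : completeNormedModType R)
  (W_separable : separable_space W)
  (inj : {linear W -> V})
  (inj_injective : injective inj)
  (inj_continuous : continuous inj)
  (W_dense : dense (range inj))
  (W_invariant : leaves_invariant inj T)
  (kappa rho : R) (kappa_gt0 : 0 < kappa) (rho_gt0 : 0 < rho)
  (T_decay : decay_estimate inj T kappa rho)
  (T_0 : forall t, 0 <= t -> T t 0 = 0) :
  exists mu : probability (borelType V) R,
    invariant_measure T eta beta mu /\
    (forall nu : probability (borelType V) R,
       invariant_measure T eta beta nu ->
       forall B : set (borelType V), measurable B -> nu B = mu B).
Proof.
pose S t v := T (Num.max 0 t) v.
have SE t v : S t v = T (Num.max 0 t) v by [].
have S_lip t v w : `|S t v - S t w| <= `|v - w|.
  by apply: T_contractive; rewrite le_max lexx.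
have S_meas v : measurable_fun setT ((S^~ v) : R -> borelType V).
  exact: time_continuous_measurable.
have S_coalesce := decay_coalesce T_contractive inj_continuous W_dense W_invariant
  kappa_gt0 rho_gt0 T_decay.
have S_add s t v : 0 <= s -> 0 <= t -> S (s + t) v = S s (S t v).
  by move=> s0 t0; rewrite /S !max_r ?addr_ge0// T_semigroup.2.
pose mu := stationary_law V_separable S_lip S_coalesce S_meas eta beta.
have mu_inv : invariant_measure T eta beta mu.
  move=> t B; apply: (fixpoint_invariant V_separable SE S_lip S_meas S_add eta_iid beta_iid
    beta_gt0 theta_gt0 beta_exp eta_beta_independent) => f mf f0.
  exact: (stationary_law_fixpoint V_separable S_lip S_coalesce S_meas eta_iid beta_iid
    theta_gt0 beta_exp eta_beta_independent mf f0).
exists mu; split => // nu nu_inv B mB.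
exact: (invariant_unique V_separable SE S_lip S_meas S_coalesce beta_iid beta_gt0
  theta_gt0 beta_exp mu_inv nu_inv mB).
Qed.
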